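(* Let $q$ be a prime power, let $\Delta$ be a positive integer, and let $a$ be the largest integer such that $q^a$ divides $\Delta$. Let $C$ be a $q$-ary $\Delta$-divisible linear code that is spanned by codewords of weight $\Delta$. Then $C$ is isomorphic to a direct sum of codes of the following forms, possibly extended by zero positions: (i) the $\frac{\Delta}{q^{k-1}}$-fold repetition $\frac{\Delta}{q^{k-1}}\cdot\mathrm{Sim}_q(k)$ of the $q$-ary simplex code of dimension $k\in\{1,\ldots,a+1\}$; and, in the binary case $q=2$, additionally: (ii) the $\frac{\Delta}{2^{k-2}}$-fold repetition $\frac{\Delta}{2^{k-2}}\cdot\mathrm{RM}_2(k)$ of the binary first order Reed-Muller code of dimension $k\in\{3,\ldots,a+2\}$; (iii) if $a\ge 1$: the $\frac{\Delta}{2}$-fold repetition $\frac{\Delta}{2}\cdot\mathrm{PC}_2(k)$ of the binary parity check code of dimension $k\ge 4$. Up to the order of the summands, the choice of these codes is uniquely determined by $C$.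
   Context: All codes are linear: a $q$-ary code of length $n$ is an $\mathbb{F}_q$-subspace of $\mathbb{F}_q^n$. The weight of a vector is the number of its nonzero coordinates. A code is $\Delta$-divisible if the weight of every codeword is divisible by $\Delta$. A zero position of a code is a coordinate at which every codeword has entry $0$. Two codes of the same length are isomorphic if one is mapped to the other by a semimonomial transformation of $\mathbb{F}_q^n$ (permutation of coordinates, multiplication of coordinates by nonzero scalars, and a field automorphism applied coordinatewise); for $q=2$ this is just a permutation of coordinates. The direct sum of a code $C\subseteq\mathbb{F}_q^n$ and $C'\subseteq\mathbb{F}_q^{n'}$ is $\{(c,c')\mid c\in C, c'\in C'\}\subseteq\mathbb{F}_q^{n+n'}$. For a positive integer $m$, the $m$-fold repetition $m\cdot C$ of $C$ is the code obtained by repeating every coordinate $m$ times, i.e. $\{(c,c,\ldots,c)\ (m\text{ copies})\mid c\in C\}$ up to isomorphism. The simplex code $\mathrm{Sim}_q(k)$ ($k\ge1$) is the code of length $\frac{q^k-1}{q-1}$ generated by the $k\times\frac{q^k-1}{q-1}$ matrix whose columns are one nonzero representative of each $1$-dimensional subspace of $\mathbb{F}_q^k$. The first order Reed-Muller code $\mathrm{RM}_q(k)$ ($k\ge 2$) is the code of length $q^{k-1}$ generated by the $k\times q^{k-1}$ matrix whose columns are all vectors of $\mathbb{F}_q^{k-1}$, extended by an additional row consisting of all ones. The parity check code $\mathrm{PC}_q(k)$ ($k\ge1$) is $\{c\in\mathbb{F}_q^{k+1}\mid c_1+\cdots+c_{k+1}=0\}$. The zero code (and an empty direct sum) is allowed.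 *)

(* Defs.v *)
From HB Require Import structures.
From mathcomp Require Import all_boot all_order all_algebra.
Set Implicit Arguments.
Unset Strict Implicit.
Unset Printing Implicit Defensive.
Import GRing.Theory.
Local Open Scope ring_scope.

(* Codes of arbitrary length are packed with their length, so that direct sums
   of families of codes can be formed. *)
Record code (F : fieldType) := Code {
  len : nat;
  words : {vspace 'rV[F]_len} }.

Definition weight (F : fieldType) (n : nat) (v : 'rV[F]_n) : nat :=
  #|[set i : 'I_n | v 0 i != 0]|.

Definition divisible_code (F : fieldType) (n : nat) (Delta : nat)
    (C : {vspace 'rV[F]_n}) : Prop :=
  forall c : 'rV[F]_n, c \in C -> (Delta %| weight c)%N.

Definition spanned_by_weight (F : finFieldType) (n : nat) (Delta : nat)
    (C : {vspace 'rV[F]_n}) : Prop :=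
  C = <<[seq c <- enum {: 'rV[F]_n} | (c \in C) && (weight c == Delta)]>>%VS.

(* The permutation of coordinates is given as a bijection of index sets; for
   n = m this is an arbitrary permutation, and no bijection exists otherwise. *)
Definition semimonomial (F : fieldType) (n m : nat) (p : 'I_m -> 'I_n)
    (d : 'I_m -> F) (sigma : {rmorphism F -> F}) (v : 'rV[F]_n) : 'rV[F]_m :=
  \row_i (d i * sigma (v 0 (p i))).

Definition isomorphic (F : fieldType) (C D : code F) : Prop :=
  exists (p : 'I_(len D) -> 'I_(len C)) (d : 'I_(len D) -> F)
         (sigma : {rmorphism F -> F}),
    [/\ bijective p, forall i, d i != 0, bijective sigma &
        forall w, w \in words D <->
          exists2 v, v \in words C & w = semimonomial p d sigma v].

Definition direct_sum (F : fieldType) (C D : code F) : code F :=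
  Code (linfun (@lsubmx F 1 (len C) (len D)) @^-1: words C :&:
        linfun (@rsubmx F 1 (len C) (len D)) @^-1: words D)%VS.

Lemma mem_direct_sum (F : fieldType) (C D : code F)
    (v : 'rV[F]_(len C + len D)) :
  v \in words (direct_sum C D) <->
  exists c c', [/\ c \in words C, c' \in words D & v = row_mx c c'].
Proof.
rewrite memv_cap -!memv_preim !lfunE /=; split.
  by move=> /andP[vC vD]; exists (lsubmx v), (rsubmx v); rewrite hsubmxK.
by move=> [c [c' [cC c'D ->]]]; rewrite row_mxKl row_mxKr cC.
Qed.

Definition zero_code (F : fieldType) (n : nat) : code F :=
  Code (0%VS : {vspace 'rV[F]_n}).

Definition direct_sums (F : fieldType) (s : seq (code F)) : code F :=
  foldr (@direct_sum F) (zero_code F 0) s.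

(* const_mx 1 *m c is the m x n matrix all of whose rows are c, and mxvec
   concatenates its rows. *)
Definition repetition (F : fieldType) (m : nat) (C : code F) : code F :=
  Code (linfun (mxvec \o mulmx (const_mx 1 : 'M[F]_(m, 1))) @: words C)%VS.

Lemma mem_repetition (F : fieldType) (m : nat) (C : code F)
    (v : 'rV[F]_(m * len C)) :
  v \in words (repetition m C) <->
  exists2 c, c \in words C & v = mxvec (\matrix_(i < m) c).
Proof.
have repE (c : 'rV[F]_(len C)) :
    (const_mx 1 : 'M[F]_(m, 1)) *m c = \matrix_(i < m) c.
  by apply/matrixP=> i j; rewrite !mxE big_ord1 !mxE mul1r.
split; first by move/memv_imgP=> [c cC ->]; exists c; rewrite // lfunE /= repE.
by move=> [c cC ->]; apply/memv_imgP; exists c; rewrite // lfunE /= repE.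
Qed.

Definition generated_code (F : fieldType) (k n : nat) (G : 'M[F]_(k, n)) :
    code F :=
  Code <<[seq row i G | i <- enum 'I_k]>>%VS.

Definition lines (F : finFieldType) (k : nat) : seq {vspace 'cV[F]_k} :=
  undup [seq <[v]>%VS | v <- enum {: 'cV[F]_k} & v != 0].

Lemma mem_lines (F : finFieldType) (k : nat) (U : {vspace 'cV[F]_k}) :
  (U \in lines F k) = (\dim U == 1%N).
Proof.
rewrite mem_undup; apply/mapP/eqP=> [[v]|dimU].
  by rewrite mem_filter => /andP[v0 _] ->; rewrite dim_vline v0.
have U0 : vpick U != 0 by rewrite vpick0 -dimv_eq0 dimU.
exists (vpick U); first by rewrite mem_filter U0 mem_enum.
by apply/esym/eqP; rewrite eqEdim -memvE memv_pick dim_vline U0 dimU.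
Qed.

(* vpick selects a nonzero vector of each line. *)
Definition simplex_mx (F : finFieldType) (k : nat) :
    'M[F]_(k, size (lines F k)) :=
  \matrix_(i, j) vpick (nth 0%VS (lines F k) j) i 0.

Definition simplex_code (F : finFieldType) (k : nat) : code F :=
  generated_code (simplex_mx F k).

Lemma len_simplex_code (F : finFieldType) (k : nat) :
  (len (simplex_code F k) * #|F|.-1)%N = (#|F| ^ k).-1.
Proof.
have -> : (#|F| ^ k).-1 = (\sum_(v : 'cV[F]_k | v != 0%R) 1)%N.
  rewrite sum1dep_card; have <- : [set~ 0] = [set v : 'cV[F]_k | v != 0].
    by apply/setP=> v; rewrite !inE.
  by rewrite cardsC1 card_mx muln1.
have card_line U : U \in lines F k ->
    (\sum_(v : 'cV[F]_k | (v != 0%R) && (U == <[v]>%VS)) 1)%N = #|F|.-1.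
  rewrite mem_lines => /eqP dimU.
  have u0 : vpick U != 0 by rewrite vpick0 -dimv_eq0 dimU.
  have EU : U = <[vpick U]>%VS.
    by apply/esym/eqP; rewrite eqEdim -memvE memv_pick dim_vline u0 dimU.
  rewrite sum1dep_card -(cardsC1 (0 : F)).
  have inj : injective (fun x : F => x *: vpick U).
    move=> x y /eqP; rewrite -subr_eq0 -scalerBl scaler_eq0 (negPf u0) orbF.
    by rewrite subr_eq0 => /eqP.
  rewrite -(card_imset _ inj); congr #|pred_of_set _|.
  apply/setP=> v; rewrite inE; apply/andP/imsetP.
    move=> [v0 /eqP Uv]; have := memv_line v; rewrite -Uv {1}EU.
    case/vlineP=> x vx; exists x => //; rewrite !inE.
    by apply: contraNneq v0 => x0; rewrite vx x0 scale0r.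
  move=> [x]; rewrite !inE => x0 ->; rewrite scaler_eq0 negb_or x0 u0.
  split=> //; rewrite eq_sym eqEdim dimU dim_vline scaler_eq0 negb_or x0 u0.
  by rewrite andbT -memvE memvZ ?memv_pick.
transitivity
    (\sum_(v : 'cV[F]_k | v != 0%R) \sum_(U <- lines F k | U == <[v]>%VS) 1)%N.
  rewrite (exchange_big_dep xpredT) //= big_seq (eq_bigr _ card_line) -big_seq.
  by rewrite big_const_seq count_predT iter_addn_0 mulnC.
apply: eq_bigr => v v0; rewrite sum1_count count_uniq_mem ?undup_uniq //.
by rewrite mem_lines dim_vline v0.
Qed.

Definition reed_muller_mx (F : finFieldType) (k : nat) :
    'M[F]_(k.-1 + 1, #|{: 'cV[F]_k.-1}|) :=
  col_mx (\matrix_(i, j) (enum_val j : 'cV[F]_k.-1) i 0) (const_mx 1).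

Definition reed_muller_code (F : finFieldType) (k : nat) : code F :=
  generated_code (reed_muller_mx F k).

Lemma len_reed_muller_code (F : finFieldType) (k : nat) :
  len (reed_muller_code F k) = (#|F| ^ k.-1)%N.
Proof. by rewrite /= card_mx muln1. Qed.

Definition parity_check_code (F : fieldType) (k : nat) : code F :=
  Code (lker (linfun (mulmxr (const_mx 1 : 'cV[F]_k.+1) : 'rV_k.+1 -> 'M_1))).

Lemma mem_parity_check_code (F : fieldType) (k : nat) (c : 'rV[F]_k.+1) :
  c \in words (parity_check_code F k) <-> \sum_i c 0 i = 0.
Proof.
have sumE : (c *m (const_mx 1 : 'cV[F]_k.+1)) = (\sum_i c 0 i)%:M.
  apply/matrixP=> i j; rewrite !ord1 !mxE mulr1n.
  by apply: eq_bigr => l _; rewrite !mxE mulr1.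
rewrite memv_ker lfunE /= sumE; split; last by move->; rewrite raddf0.
by move/eqP/matrixP/(_ 0 0); rewrite !mxE mulr1n.
Qed.

Inductive summand : Type :=
  | Sim of nat
  | RM of nat
  | PC of nat.

Lemma summand_eq_dec (s t : summand) : {s = t} + {s <> t}.
Proof. by do !decide equality. Qed.

HB.instance Definition _ := hasDecEq.Build summand (compareP summand_eq_dec).

Definition admissible (q a : nat) (s : summand) : bool :=
  match s with
  | Sim k => (1 <= k <= a + 1)%N
  | RM k => ((q == 2) && (3 <= k <= a + 2))%N
  | PC k => [&& q == 2, 1 <= a & 4 <= k]%N
  end.

(* All divisions are exact when the summand is admissible and q ^ a divides
   Delta. *)
Definition summand_code (F : finFieldType) (Delta : nat) (s : summand) :
    code F :=
  match s with
  | Sim k => repetition (Delta %/ #|F| ^ (k - 1))%N (simplex_code F k)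
  | RM k => repetition (Delta %/ 2 ^ (k - 2))%N (reed_muller_code F k)
  | PC k => repetition (Delta %/ 2)%N (parity_check_code F k)
  end.

(* z is the number of additional zero positions. *)
Definition decomposition (F : finFieldType) (Delta a : nat) (C : code F)
    (s : seq summand) : Prop :=
  all (admissible #|F| a) s /\
  exists z : nat,
    isomorphic C
      (direct_sum (direct_sums [seq summand_code F Delta t | t <- s])
                  (zero_code F z)).

(* Main.v *)
(* Two words of weight Delta with meeting supports that are not proportional
   span a code of constant weight Delta and have q t = (q - 1) Delta common
   support positions t.  For q > 2 this makes "supports meet" transitive on the
   words of weight Delta, so that each class together with 0 is a
   constant-weight code, i.e. a repeated simplex code (the hyperplane sums of
   weights determine the multiplicity of every projective point among the
   coordinates), and distinct classes have disjoint supports.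

   For q = 2, if transitivity fails, there are at least four disjoint blocks of
   size Delta/2 whose pairwise unions are words.  For a maximal such system a
   further word of weight Delta meeting the blocks is either a union of two
   blocks, or there are exactly four blocks and it takes a quarter Delta from
   each.  More than four blocks give a repeated parity check code; with four
   blocks everything lives on 2 Delta positions, contains the all-one word, and
   the words vanishing at a fixed position form a constant-weight code, which
   gives a repeated Reed-Muller code.

   For uniqueness, attach to each coordinate i the number of words of weight
   Delta that are nonzero at i and the number of coordinates j with the same
   zero pattern as i.  These two numbers are constant on every summand, separate
   the types of summands, and do not change when a code is embedded in a direct
   sum. *)
Require Import Defs.
From mathcomp Require Import all_boot all_order all_algebra.
From mathcomp Require Import zify ring.
Set Implicit Arguments.
Unset Strict Implicit.
Unset Printing Implicit Defensive.
Import GRing.Theory.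
Local Open Scope ring_scope.

(** * Linear forms over a finite field *)

(** The map [shift (s' - s)] injects the fibre of [f] over [s] into the fibre over [s'], so all
    [#|F|] fibres of [f] on [A] have the same size. *)
Lemma card_equidistributed (F : finZmodType) (T : finType) (A : {set T})
    (f : T -> F) (shift : F -> T -> T) (e : F) :
  (forall t, injective (shift t)) ->
  (forall t u, u \in A -> shift t u \in A) ->
  (forall t u, u \in A -> f (shift t u) = f u + t) ->
  #|A| = (#|F| * #|[set u in A | f u == e]|)%N.
Proof.
move=> shI shA shf.
have le s s' : (#|[set u in A | f u == s]| <= #|[set u in A | f u == s']|)%N.
  rewrite -(card_imset _ (shI (s' - s))); apply/subset_leq_card/subsetP.
  move=> _ /imsetP[u + ->]; rewrite !inE => /andP[uA /eqP fu].
  by rewrite shA ?shf ?fu //= addrC subrK.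
rewrite -sum1_card (partition_big f xpredT) //=.
rewrite (eq_bigr (fun=> #|[set u in A | f u == e]|)) ?sum_nat_const //.
move=> s _.
have -> : (\sum_(i in A | f i == s) 1)%N = #|[set u in A | f u == s]|.
  by rewrite -sum1_card; apply: eq_bigl => u; rewrite inE.
by apply/eqP; rewrite eqn_leq !le.
Qed.

Section LinearForms.
Variable F : finFieldType.

Lemma card_field_gt1 : (1 < #|F|)%N.
Proof. by apply/card_gt1P; exists 0, 1; rewrite ?inE // eq_sym oner_neq0. Qed.

Definition dot k (u : 'rV[F]_k) (x : 'cV[F]_k) : F := (u *m x) 0 0.

Lemma dotE k (u : 'rV[F]_k) x : dot u x = \sum_i u 0 i * x i 0.
Proof. by rewrite /dot mxE. Qed.

Lemma dotDl k (u v : 'rV[F]_k) x : dot (u + v) x = dot u x + dot v x.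
Proof. by rewrite /dot mulmxDl mxE. Qed.

Lemma dotZl k c (u : 'rV[F]_k) x : dot (c *: u) x = c * dot u x.
Proof. by rewrite /dot -scalemxAl mxE. Qed.

Lemma dotDr k (u : 'rV[F]_k) x y : dot u (x + y) = dot u x + dot u y.
Proof. by rewrite /dot mulmxDr mxE. Qed.

Lemma dotZr k c (u : 'rV[F]_k) x : dot u (c *: x) = c * dot u x.
Proof. by rewrite /dot -scalemxAr mxE. Qed.

Lemma dot_deltal k i (x : 'cV[F]_k) : dot (delta_mx 0 i) x = x i 0.
Proof. by rewrite /dot -rowE mxE. Qed.

Lemma dot_deltar k i (u : 'rV[F]_k) : dot u (delta_mx i 0) = u 0 i.
Proof. by rewrite /dot -colE mxE. Qed.

Lemma dot_col k n (u : 'rV[F]_k) (B : 'M[F]_(k, n)) j :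
  dot u (col j B) = (u *m B) 0 j.
Proof. by rewrite dotE mxE; apply: eq_bigr => i _; rewrite mxE. Qed.

Lemma dot0r k (u : 'rV[F]_k) : dot u 0 = 0.
Proof. by rewrite /dot mulmx0 mxE. Qed.

Lemma dot_nz k (x : 'cV[F]_k) : x != 0 -> exists u, dot u x != 0.
Proof.
move=> x0; apply/existsP; apply: contraNT x0 => /existsPn h.
apply/eqP/colP=> i; rewrite mxE -dot_deltal.
by have := h (delta_mx 0 i); rewrite negbK => /eqP.
Qed.

Lemma dot_nzl k (u : 'rV[F]_k) : u != 0 -> exists x, dot u x != 0.
Proof.
move=> u0; apply/existsP; apply: contraNT u0 => /existsPn h.
apply/eqP/rowP=> i; rewrite mxE -dot_deltar.
by have := h (delta_mx i 0); rewrite negbK => /eqP.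
Qed.

Lemma dot_separates k (x y : 'cV[F]_k) : x != 0 -> y \notin <[x]>%VS ->
  exists u, dot u x = 0 /\ dot u y != 0.
Proof.
move=> x0 yx.
have [i xi] : exists i, x i 0 != 0.
  apply/existsP; apply: contraNT x0 => /existsPn h.
  by apply/eqP/colP=> i; rewrite mxE; have := h i; rewrite negbK => /eqP.
have [[j hj]|h] : (exists j, y j 0 * x i 0 != y i 0 * x j 0)
    \/ forall j, y j 0 * x i 0 = y i 0 * x j 0.
- case: (boolP [exists j, y j 0 * x i 0 != y i 0 * x j 0]).
    by move/existsP; left.
  by move/existsPn=> h; right=> j; have := h j; rewrite negbK => /eqP.
(* This form vanishes at [x] and takes at [y] the value of the nonzero two-by-two minor of [x] and
   [y] in rows [i] and [j]. *)
- exists (x i 0 *: delta_mx 0 j - x j 0 *: delta_mx 0 i).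
  rewrite -scaleNr !dotDl !dotZl !dot_deltal; split; first by ring.
  by apply: contraNneq hj => e; rewrite -subr_eq0 -e; apply/eqP; ring.
case/vlineP: yx; exists (y i 0 / x i 0); apply/colP=> j.
by rewrite mxE mulrAC -h mulfK.
Qed.

Lemma card_kernel k (x : 'cV[F]_k) : x != 0 ->
  (#|F| ^ k = #|F| * #|[set u | dot u x == 0%R]|)%N.
Proof.
move=> /dot_nz[u0 hu0].
have := @card_equidistributed F _ [set: 'rV[F]_k] (fun u => dot u x)
  (fun t u => u + (t / dot u0 x) *: u0) 0.
rewrite cardsT card_mx mul1n => ->.
- by congr (_ * #|pred_of_set _|)%N; apply/setP=> u; rewrite !inE.
- by move=> t; apply: addIr.
- by move=> *; rewrite inE.
by move=> t u _; rewrite dotDl dotZl divfK.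
Qed.

Lemma card_kernel2 k (x y : 'cV[F]_k) : x != 0 -> y \notin <[x]>%VS ->
  (#|[set u | dot u x == 0%R]| =
   #|F| * #|[set u | (dot u x == 0%R) && (dot u y == 0%R)]|)%N.
Proof.
move=> x0 /(dot_separates x0)[u0 [hu0 hu1]].
rewrite (@card_equidistributed F _ _ (fun u => dot u y)
  (fun t u => u + (t / dot u0 y) *: u0) 0).
- by congr (_ * #|pred_of_set _|)%N; apply/setP=> u; rewrite !inE.
- by move=> t; apply: addIr.
- by move=> t u; rewrite !inE dotDl dotZl hu0 mulr0 addr0.
by move=> t u _; rewrite dotDl dotZl divfK.
Qed.

Lemma card_affine_kernel k (u : 'rV[F]_k) e : u != 0 ->
  (#|F| ^ k = #|F| * #|[set x | (dot u x + e)%R == 0%R]|)%N.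
Proof.
move=> /dot_nzl[x0 hx0].
have := @card_equidistributed F _ [set: 'cV[F]_k] (fun x => dot u x + e)
  (fun t x => x + (t / dot u x0) *: x0) 0.
rewrite cardsT card_mx muln1 => ->.
- by congr (_ * #|pred_of_set _|)%N; apply/setP=> x; rewrite !inE.
- by move=> t; apply: addIr.
- by move=> *; rewrite inE.
by move=> t x _; rewrite dotDr dotZr divfK // addrAC.
Qed.

End LinearForms.

(** * Constant-weight codes *)

Section ConstantWeight.
Variable F : finFieldType.

Lemma weightE n (v : 'rV[F]_n) : weight v = (\sum_(j < n) (v 0%R j != 0%R))%N.
Proof. by rewrite -big_mkcond sum1dep_card. Qed.

Lemma weight0 n : weight (0 : 'rV[F]_n) = 0%N.
Proof. by rewrite weightE big1 // => i _; rewrite mxE eqxx. Qed.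

Lemma weight_eq0 n (v : 'rV[F]_n) : weight v = 0%N -> v = 0.
Proof.
move/eqP; rewrite cards_eq0 => /eqP h; apply/rowP=> i; rewrite mxE.
have : i \notin [set i | v 0 i != 0] by rewrite h inE.
by rewrite inE negbK => /eqP.
Qed.

(** Double counting of pairs of a word and a position where it is nonzero. The code is parametrized
    by [u *m B], so a position acts on [u] through a column of [B]. *)
Lemma sum_weight k n (B : 'M[F]_(k, n)) (P : pred 'rV[F]_k) :
  (\sum_(u | P u) weight (u *m B) =
   \sum_(j < n) #|[set u | P u && (dot u (col j B) != 0%R)]|)%N.
Proof.
under eq_bigr do rewrite weightE.
rewrite exchange_big /=; apply: eq_bigr => j _.
rewrite -sum1dep_card -big_mkcondr /=.
by apply: eq_bigl => u; rewrite dot_col.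
Qed.

Lemma sum_const_weight k n (B : 'M[F]_(k, n)) (P : pred 'rV[F]_k) Delta :
  (forall u, u != 0 -> weight (u *m B) = Delta) -> P 0 ->
  (\sum_(u | P u) weight (u *m B) = (#|[set u | P u]| - 1) * Delta)%N.
Proof.
move=> wB P0; rewrite (bigD1 0) //= mul0mx weight0 add0n.
rewrite (eq_bigr (fun=> Delta)); last by move=> u /andP[_ /wB].
rewrite sum_nat_cond_const; congr (_ * _)%N.
rewrite (cardsD1 0 [set u | P u]) inE P0 add1n subn1 /=.
by apply: eq_card => u; rewrite !inE andbC.
Qed.

Lemma card_dot_nz k (x : 'cV[F]_k) : x != 0 ->
  #|[set u | dot u x != 0]| = (#|F| ^ k - #|F| ^ k.-1)%N.
Proof.
case: k x => [|k] x x0; first by rewrite (flatmx0 x) eqxx in x0.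
have q0 : (0 < #|F|)%N by apply/card_gt0P; exists 0.
have /eqP := card_kernel x0; rewrite expnS eqn_pmul2l // => /eqP h.
have cT : #|[set: 'rV[F]_k.+1]| = (#|F| ^ k.+1)%N.
  by rewrite cardsT card_mx mul1n.
rewrite -?expnS -cT /= h.
rewrite -(cardsID [set u | dot u x == 0] [set: _]) !setTI setTD addKn.
by apply: eq_card => u; rewrite !inE.
Qed.

(* Summing weights over the whole code and over the hyperplane dual to [x]
   gives two linear equations that determine the multiplicity of the line of
   [x] among the columns. *)
Lemma const_weight_columns k n (B : 'M[F]_(k, n)) Delta (x : 'cV[F]_k) :
  (forall u, u != 0 -> weight (u *m B) = Delta) -> x != 0 ->
  Delta = (#|[set j | (col j B != 0%R) && (col j B \in <[x]>%VS)]| *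
           #|F| ^ k.-1)%N.
Proof.
move=> wB x0.
case: k B x wB x0 => [|k] B x wB x0; first by rewrite (flatmx0 x) eqxx in x0.
have q1 := card_field_gt1 F.
have /eqP := card_kernel x0; rewrite expnS eqn_pmul2l; last by lia.
move/eqP=> cH; have Kp : (0 < #|F| ^ k)%N by rewrite expn_gt0; lia.
have := sum_const_weight wB (P := xpredT) isT; rewrite sum_weight.
rewrite (eq_bigr (fun j => (col j B != 0%R) * (#|F| ^ k.+1 - #|F| ^ k)%N)%N).
  rewrite -big_distrl /= -big_mkcond sum1dep_card.
  rewrite -(cardsID [set j | col j B \in <[x]>%VS]).
  have -> : #|[set _ : 'rV[F]_k.+1 | true]| = (#|F| ^ k.+1)%N.
    by rewrite cardsT card_mx mul1n.
  move=> e1.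
  have := @sum_const_weight _ _ _ (fun u => dot u x == 0) _ wB.
  rewrite /dot mul0mx mxE eqxx => /(_ isT); rewrite -/dot sum_weight -cH.
  (* The contribution of column [j] to the hyperplane sum: nothing on the line of [x], and otherwise
     the hyperplane minus a subspace of index [#|F|] in it. The factor [#|F|] avoids a power with
     exponent [k - 1], which would be truncated at [k = 0]. *)
  have e j : (#|F| * #|[set u | (dot u x == 0%R) && (dot u (col j B) != 0%R)]|
      = (col j B \notin <[x]>%VS) * ((#|F| - 1) * #|F| ^ k))%N.
    case: (boolP (_ \in _)) => [/vlineP[c ->]|jx] /=.
      rewrite mul0n; apply/eqP; rewrite muln_eq0 cards_eq0; apply/orP; right.
      apply/eqP/setP=> u; rewrite !inE; apply/negP=> /andP[/eqP h].
      by rewrite dotZr h mulr0 eqxx.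
    have := card_kernel2 x0 jx; rewrite -cH => h.
    have := cardsID [set u | dot u (col j B) == 0] [set u | dot u x == 0].
    rewrite -cH; set a := #|_|; set b := #|_|.
    have -> : a = #|[set u | (dot u x == 0) && (dot u (col j B) == 0)]|.
      by apply: eq_card => u; rewrite !inE.
    have -> : b = #|[set u | (dot u x == 0) && (dot u (col j B) != 0)]|.
      by apply: eq_card => u; rewrite !inE andbC.
    by move=> hab; rewrite mul1n mulnBl mul1n {2}h -mulnBr -{}hab addKn.
  move/(congr1 (muln #|F|)); rewrite big_distrr /= (eq_bigr _ (fun j _ => e j)).
  rewrite -big_distrl /= -big_mkcond sum1dep_card => e2.
  move: e1 e2; set mu := #|_|; set nu := #|_|; set nu' := #|_|.
  have -> : nu' = nu.
    apply: eq_card => j; rewrite !inE; case: eqP => [->|]; rewrite ?andbT //.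
    by rewrite mem0v.
  have -> : #|[set j | (col j B != 0) && (col j B \in <[x]>%VS)]| = mu.
    by apply: eq_card => j; rewrite !inE.
  rewrite expnS; move: q1 (#|F| ^ k)%N Kp; move: #|F| => q q1 K Kp e1 e2.
  (* With [mu] nonzero columns on the line of [x] and [nu] columns off it, the two sums read (mu +
     nu)(q - 1)K = (qK - 1)Delta and nu(q - 1)K = q(K - 1)Delta; their difference is mu(q - 1)K = (q
     - 1)Delta. Successors replace [q] and [K] because subtraction is truncated. *)
  have [q' qE] : exists q', q = q'.+2 by exists (q - 2)%N; lia.
  have [K' KE] : exists K', K = K'.+1 by exists (K - 1)%N; lia.
  apply/eqP; rewrite -(@eqn_pmul2l q'.+1) //; apply/eqP.
  have e3 : ((mu + nu) * (q'.+1 * K) = (q * K - 1) * Delta)%N.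
    by rewrite -e1; congr (_ * _)%N; rewrite qE; lia.
  have e4 : (nu * (q'.+1 * K) = q * ((K - 1) * Delta))%N.
    by rewrite -e2 qE; congr (_ * (_ * _))%N; lia.
  have e5 : ((q * K - 1) * Delta = q * ((K - 1) * Delta) + q'.+1 * Delta)%N.
    by rewrite mulnA -mulnDl; congr (_ * _)%N; rewrite qE KE; lia.
  move: e3; rewrite e5 -e4 mulnDl addnC => /addnI <-.
  by rewrite mulnCA.
move=> j _; case: eqP => [->|/eqP j0] /=.
  rewrite mul0n; apply/eqP; rewrite cards_eq0; apply/eqP/setP=> u.
  by rewrite !inE dot0r eqxx.
rewrite mul1n -(card_dot_nz j0).
by apply: eq_card => u; rewrite !inE.
Qed.

End ConstantWeight.

(** * Embeddings of codes *)

Section Embeddings.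
Variable F : finFieldType.

(* [C] is a monomial copy of [E] extended by zero positions, and no coordinate
   of the copy is a zero position. *)
Definition embeds (E : code F) n (C : {vspace 'rV[F]_n}) : Prop :=
  exists (p : 'I_(len E) -> 'I_n) (d : 'I_(len E) -> F),
    [/\ injective p, forall i, d i != 0,
        forall i, exists2 c, c \in C & c 0 (p i) != 0 &
        forall v, v \in C <-> exists w, [/\ w \in words E,
          forall i, v 0 (p i) = d i * w 0 i &
          forall j, j \notin codom p -> v 0 j = 0]].

Definition extend N n (p : 'I_N -> 'I_n) (d : 'I_N -> F) (w : 'rV[F]_N) :
  'rV[F]_n := \row_j \sum_(i | p i == j) d i * w 0 i.

Lemma extend_codom N n (p : 'I_N -> 'I_n) d w i :
  injective p -> extend p d w 0 (p i) = d i * w 0 i.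
Proof. by move=> pI; rewrite mxE (big_pred1 i) // => i'; apply: inj_eq. Qed.

Lemma extend_out N n (p : 'I_N -> 'I_n) d w j :
  j \notin codom p -> extend p d w 0 j = 0.
Proof.
move=> pj; rewrite mxE big_pred0 // => i; apply: contraNF pj => /eqP <-.
exact: codom_f.
Qed.

Lemma embeds_zero n : embeds (zero_code F 0) (0%VS : {vspace 'rV[F]_n}).
Proof.
exists (fun i : 'I_0 => match i with Ordinal _ h => False_rect _ (notF h) end).
exists (fun _ => 1); split; try by move=> [].
move=> v; rewrite memv0; split=> [/eqP ->|[w [_ _ h]]].
  by exists 0; split=> [|[]|j _]; rewrite ?mem0v ?mxE.
apply/eqP/rowP=> j; rewrite h ?mxE //.
by apply/negP=> /codomP[[]].
Qed.

Lemma embeds_direct_sum (E1 E2 : code F) n (C1 C2 : {vspace 'rV[F]_n}) :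
  embeds E1 C1 -> embeds E2 C2 ->
  (forall c1 c2 j, c1 \in C1 -> c2 \in C2 -> c1 0 j != 0 -> c2 0 j = 0) ->
  embeds (direct_sum E1 E2) (C1 + C2)%VS.
Proof.
move=> [p1 [d1 [p1I d1n s1 e1]]] [p2 [d2 [p2I d2n s2 e2]]] disj.
(* Each position of a copy is nonzero in some word, so a common position would contradict [disj]. *)
have p12 i j : p1 i <> p2 j.
  move=> h; have [c1 c1C c1i] := s1 i; have [c2 c2C c2j] := s2 j.
  by move: c2j; rewrite -h (disj c1 c2) ?eqxx.
pose p (i : 'I_(len E1 + len E2)) :=
  match split i with inl a => p1 a | inr b => p2 b end.
pose d (i : 'I_(len E1 + len E2)) :=
  match split i with inl a => d1 a | inr b => d2 b end.
have pl i : p (lshift _ i) = p1 i by rewrite /p (unsplitK (inl i)).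
have pr i : p (rshift _ i) = p2 i by rewrite /p (unsplitK (inr i)).
have dl i : d (lshift _ i) = d1 i by rewrite /d (unsplitK (inl i)).
have dr i : d (rshift _ i) = d2 i by rewrite /d (unsplitK (inr i)).
have C1z c1 j : c1 \in C1 -> j \notin codom p1 -> c1 0 j = 0.
  by move=> /e1[w [_ _]]; apply.
have C2z c2 j : c2 \in C2 -> j \notin codom p2 -> c2 0 j = 0.
  by move=> /e2[w [_ _]]; apply.
have n12 i : p1 i \notin codom p2 by apply/negP=> /codomP[j /p12].
have n21 i : p2 i \notin codom p1 by apply/negP=> /codomP[j /esym /p12].
exists p, d; split.
- move=> i j; rewrite -[i]splitK -[j]splitK.
  case: (split i) => i'; case: (split j) => j' /=; rewrite ?pl ?pr.
  + by move/p1I->.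
  + by move/p12.
  + by move/esym/p12.
  + by move/p2I->.
- by move=> i; rewrite -[i]splitK; case: (split i) => i' /=; rewrite ?dl ?dr.
- move=> i; rewrite -[i]splitK; case: (split i) => i' /=; rewrite ?pl ?pr.
    by have [c cC ci] := s1 i'; exists c => //; apply: (subvP (addvSl _ _)).
  by have [c cC ci] := s2 i'; exists c => //; apply: (subvP (addvSr _ _)).
move=> v; split.
  case/memv_addP=> c1 c1C [c2 c2C ->].
  have [w1 [w1E h1 h1']] := (e1 c1).1 c1C.
  have [w2 [w2E h2 h2']] := (e2 c2).1 c2C.
  exists (row_mx w1 w2); split; first by apply/mem_direct_sum; exists w1, w2.
    move=> i; rewrite -[i]splitK; case: (split i) => i' /=; rewrite ?pl ?pr mxE.
      by rewrite dl row_mxEl h1 h2' // addr0.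
    by rewrite dr row_mxEr h2 h1' // add0r.
  move=> j jp; rewrite mxE h1' ?h2' ?addr0 //.
    by apply: contra jp => /codomP[i ->]; rewrite -pr codom_f.
  by apply: contra jp => /codomP[i ->]; rewrite -pl codom_f.
case=> w [/mem_direct_sum[w1 [w2 [w1E w2E ->]]] h h'].
have c1C : extend p1 d1 w1 \in C1.
  by apply/e1; exists w1; split=> // *; rewrite ?extend_codom ?extend_out.
have c2C : extend p2 d2 w2 \in C2.
  by apply/e2; exists w2; split=> // *; rewrite ?extend_codom ?extend_out.
apply/memv_addP; exists (extend p1 d1 w1) => //; exists (extend p2 d2 w2) => //.
apply/rowP=> j; rewrite mxE.
have [/codomP[i ->]|j1] := boolP (j \in codom p1).
  by rewrite -[in LHS]pl h extend_codom // extend_out // row_mxEl dl addr0.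
have [/codomP[i ->]|j2] := boolP (j \in codom p2).
  by rewrite -[in LHS]pr h extend_codom // extend_out // row_mxEr dr add0r.
rewrite !extend_out // addr0 h' //; apply/negP=> /codomP[i].
rewrite -[i]splitK; case: (split i) => i' /=; rewrite ?pl ?pr => ji.
  by rewrite ji codom_f in j1.
by rewrite ji codom_f in j2.
Qed.

(** The complement of the image of [p] supplies the zero positions. The scalars are inverted, since
    [embeds] describes [C] in terms of [E] whereas the isomorphism starts from [C]. *)
Lemma embeds_isomorphic (E : code F) n (C : {vspace 'rV[F]_n}) :
  embeds E C -> exists z, isomorphic (Code C) (direct_sum E (zero_code F z)).
Proof.
move=> [p [d [pI dn s e]]].
pose S := ~: [set p i | i in 'I_(len E)].
exists #|S|.
pose pp (i : 'I_(len E + #|S|)) : 'I_n :=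
  match split i with inl a => p a | inr b => enum_val b end.
pose dd (i : 'I_(len E + #|S|)) :=
  match split i with inl a => (d a)^-1 | inr b => 1 end.
have pl i : pp (lshift _ i) = p i by rewrite /pp (unsplitK (inl i)).
have pr i : pp (rshift _ i) = enum_val i by rewrite /pp (unsplitK (inr i)).
have dl i : dd (lshift _ i) = (d i)^-1 by rewrite /dd (unsplitK (inl i)).
have nS (b : 'I_#|S|) : enum_val b \notin codom p.
  have := enum_valP b; rewrite inE; apply: contra => /codomP[i ->].
  exact: imset_f.
exists pp, dd, (idfun : {rmorphism F -> F}); split.
- apply: inj_card_bij.
    move=> i j; rewrite -[i]splitK -[j]splitK.
    case: (split i) => i'; case: (split j) => j' /=; rewrite ?pl ?pr.
    + by move/pI->.
    + by move=> h; have := nS j'; rewrite -h codom_f.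
    + by move=> h; have := nS i'; rewrite h codom_f.
    + by move/enum_val_inj->.
  have := cardsC [set p i | i in 'I_(len E)].
  by rewrite card_imset // !card_ord /= => h; apply: eq_leq; rewrite [RHS]h.
- move=> i; rewrite /dd; case: (split i) => a; rewrite ?oner_neq0 //.
  by rewrite invr_eq0.
- by exists idfun.
move=> w; split.
  case/mem_direct_sum=> c [c' [cE /=]]; rewrite memv0 => /eqP -> ->.
  exists (extend p d c).
    by apply/e; exists c; split=> // *; rewrite ?extend_codom ?extend_out.
  apply/rowP=> i; rewrite [RHS]mxE -[i]splitK; case: (split i) => i' /=.
    by rewrite row_mxEl pl dl extend_codom // mulKf.
  by rewrite row_mxEr pr extend_out // mulr0 mxE.
case=> v /e[c [cE h h']] ->; apply/mem_direct_sum; exists c, 0; split=> //=.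
  by rewrite mem0v.
apply/rowP=> i; rewrite mxE -[i]splitK; case: (split i) => i' /=.
  by rewrite row_mxEl pl dl h mulKf.
by rewrite row_mxEr pr h' // mulr0 mxE.
Qed.

(** [f j] is the position of [E] that [j] copies, and [None] marks a zero position. When all fibres
    have size [m], enumerating each fibre arranges the copies as an [m] by [len E] matrix, which
    [mxvec] flattens. *)
Lemma embeds_repetition m (E : code F) n (C : {vspace 'rV[F]_n})
    (f : 'I_n -> option 'I_(len E)) (d : 'I_n -> F) :
  (forall b, #|[set j | f j == Some b]| = m) ->
  (forall j, d j != 0) ->
  (forall j, f j != None -> exists2 c, c \in C & c 0 j != 0) ->
  (forall v, v \in C <-> exists2 w, w \in words E &
     forall j, v 0 j = if f j is Some b then d j * w 0 b else 0) ->
  embeds (repetition m E) C.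
Proof.
move=> cf dn sC eC.
have [g gK Kg'] := curry_mxvec_bij m (len E).
have Kg i := Kg' i isT.
pose p (i : 'I_(m * len E)) : 'I_n :=
  enum_val (cast_ord (esym (cf (g i).2)) (g i).1).
have fp i : f (p i) = Some (g i).2.
  have := enum_valP (cast_ord (esym (cf (g i).2)) (g i).1).
  by rewrite inE => /eqP.
have pj j b : f j = Some b -> exists a, j = p (mxvec_index a b).
  move=> fj; have jS : j \in [set j | f j == Some b] by rewrite inE fj.
  exists (cast_ord (cf b) (enum_rank_in jS j)).
  have /= gE := gK (cast_ord (cf b) (enum_rank_in jS j), b) isT.
  rewrite /p gE /= cast_ordK enum_rankK_in //.
exists p, (fun i => d (p i)); split=> //.
- move=> i j hp; have := fp i; rewrite hp fp => -[/esym h].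
  rewrite -[i]Kg -[j]Kg; congr (_ _); move: hp; rewrite /p.
  case: (g i) (g j) h => a b [a' b'] /= h; rewrite -{}h.
  by move/enum_val_inj/cast_ord_inj->.
- by move=> i; apply: sC; rewrite fp.
move=> v; split.
  case/eC=> w wE h; exists (mxvec (\matrix_(i < m) w)); split.
  - by apply/mem_repetition; exists w.
  - move=> i; rewrite h fp; congr (_ * _).
    by rewrite -[in RHS](Kg i); case: (g i) => a b; rewrite mxvecE mxE.
  - move=> j; rewrite h; case fj: (f j) => [b|//].
    by have [a ->] := pj _ _ fj; rewrite codom_f.
case=> w [/mem_repetition[c cE ->] h h']; apply/eC; exists c => // j.
case fj: (f j) => [b|].
  by have [a ->] := pj _ _ fj; rewrite h mxvecE mxE.
by apply: h'; apply/negP=> /codomP[i ji]; rewrite ji fp in fj.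
Qed.

Lemma mem_generated_code k n (G : 'M[F]_(k, n)) (w : 'rV[F]_n) :
  w \in words (generated_code G) <-> exists u, w = u *m G.
Proof.
split=> /=.
  suff /subvP h : (<<[seq row i G | i <- enum 'I_k]>> <=
      limg (linfun (mulmxr G : 'rV[F]_k -> 'rV[F]_n)))%VS.
    by move/h/memv_imgP=> [u _ ->]; exists u; rewrite lfunE.
  apply/span_subvP=> _ /mapP[i _ ->]; apply/memv_imgP.
  by exists (delta_mx 0 i); rewrite ?memvf // lfunE /= rowE.
case=> u ->; rewrite mulmx_sum_row; apply: rpred_sum => i _.
by apply/rpredZ/memv_span/map_f; rewrite mem_enum.
Qed.
End Embeddings.

(** * Constant-weight codes are repeated simplex codes *)

Section SimplexSummand.
Variable F : finFieldType.

Lemma vspace_basis_mx n (D : {vspace 'rV[F]_n}) :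
  exists B : 'M[F]_(\dim D, n),
    (forall v, v \in D <-> exists u : 'rV[F]_(\dim D), v = u *m B) /\
    (forall u : 'rV[F]_(\dim D), u *m B = 0 -> u = 0).
Proof.
pose B : 'M[F]_(\dim D, n) := \matrix_(i < \dim D) (vbasis D)`_i.
have BE (u : 'rV[F]_(\dim D)) : u *m B = \sum_(i < \dim D) u 0 i *: (vbasis D)`_i.
  by rewrite mulmx_sum_row; apply: eq_bigr => i _; rewrite rowK.
exists B; split=> [v|u].
  split=> [vD|[u ->]].
    exists (\row_i coord (vbasis D) i v); rewrite BE {1}(coord_vbasis vD).
    by apply: eq_bigr => i _; rewrite mxE.
  rewrite BE; apply: rpred_sum => i _; apply: rpredZ; apply: vbasis_mem.
  by apply: mem_nth; rewrite size_tuple.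
rewrite BE => h; apply/rowP=> i; rewrite mxE.
have /freeP := basis_free (vbasisP D); apply.
exact: h.
Qed.

Lemma memv_line_nz k (x y : 'cV[F]_k) : y != 0 ->
  (y \in <[x]>%VS) = (<[y]>%VS == <[x]>%VS).
Proof.
move=> y0; apply/idP/eqP=> [yx|<-]; last exact: memv_line.
apply/eqP; rewrite eqEdim -memvE yx /=; case/vlineP: yx y0 => c ->.
rewrite scaler_eq0 negb_or => /andP[c0 x0].
by rewrite !dim_vline scaler_eq0 negb_or c0 x0.
Qed.

Lemma vpick_line k (U : {vspace 'cV[F]_k}) : U \in lines F k ->
  vpick U != 0 /\ U = <[vpick U]>%VS.
Proof.
rewrite mem_lines => /eqP dU.
have U0 : vpick U != 0 by rewrite vpick0 -dimv_eq0 dU.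
split=> //; apply/esym/eqP.
by rewrite eqEdim -memvE memv_pick dim_vline U0 dU.
Qed.

Lemma col_simplex_mx k (b : 'I_(size (lines F k))) :
  col b (simplex_mx F k) = vpick (nth 0%VS (lines F k) b).
Proof. by apply/colP=> i; rewrite !mxE. Qed.

(** Constant weight makes every line contain the same number of nonzero columns of [B], by
    [const_weight_columns]; hence [B] is a repeated simplex matrix up to order, scalars and zero
    columns. *)
Lemma embeds_simplex k n (B : 'M[F]_(k, n)) (D : {vspace 'rV[F]_n}) Delta :
  (0 < k)%N -> (forall v, v \in D <-> exists u, v = u *m B) ->
  (forall u, u != 0 -> weight (u *m B) = Delta) ->
  (#|F| ^ (k - 1) %| Delta)%N /\ embeds (summand_code F Delta (Sim k)) D.
Proof.
move=> k0 DB wB.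
have q0 : (0 < #|F|)%N by apply/card_gt0P; exists 0.
have cB x : x != 0 -> #|[set j | (col j B != 0) && (col j B \in <[x]>%VS)]| =
    (Delta %/ #|F| ^ (k - 1))%N.
  move=> x0; rewrite (const_weight_columns wB x0) subn1 mulnK //.
  by rewrite expn_gt0 q0.
split.
  have x0 : (const_mx 1 : 'cV[F]_k) != 0.
    apply/eqP=> /matrixP/(_ (Ordinal k0) 0)/eqP.
    by rewrite !mxE oner_eq0.
  by rewrite (const_weight_columns wB x0) subn1 dvdn_mull.
(* The zero space is not in [lines], so its index is out of range and [insub] sends a zero column to
   [None]. *)
pose f j : option 'I_(size (lines F k)) :=
  insub (index <[col j B]>%VS (lines F k)).
have fE j b : (f j == Some b) =
    (col j B != 0) && (col j B \in <[vpick (nth 0%VS (lines F k) b)]>%VS).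
  have bl : nth 0%VS (lines F k) b \in lines F k by rewrite mem_nth.
  have [b0 bE] := vpick_line bl; rewrite -bE /f.
  case: insubP => [b' hb' b'E|].
    rewrite index_mem mem_lines dim_vline in hb'.
    have j0 : col j B != 0 by case: (_ != _) hb'.
    rewrite j0 /= bE memv_line_nz // -bE; apply/eqP/eqP=> [[<-]|h].
      by rewrite b'E nth_index // mem_lines dim_vline j0.
    congr Some; apply: val_inj; rewrite /= b'E h index_uniq //.
    exact: undup_uniq.
  rewrite index_mem mem_lines dim_vline; by case: (col j B != 0).
have ex_d j : exists c : F, c != 0 /\ forall b, f j = Some b ->
    col j B = c *: vpick (nth 0%VS (lines F k) b).
  case fj: (f j) => [b|]; last by exists 1; rewrite oner_neq0.
  move/eqP: fj; rewrite fE => /andP[j0 /vlineP[c hc]].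
  exists c; split=> [|_ [<-] //].
  by apply: contraNneq j0 => c0; rewrite hc c0 scale0r.
have [d hd] := fin_all_exists ex_d.
have fN j : f j = None -> col j B = 0.
  rewrite /f; case: insubP => // + _.
  by rewrite index_mem mem_lines dim_vline; case: (col j B =P 0).
apply: (@embeds_repetition F _ (simplex_code F k) n D f d).
- move=> b; rewrite -(@cB (vpick (nth 0%VS (lines F k) b))).
    by apply: eq_card => j; rewrite !inE fE.
  by apply: (vpick_line _).1; rewrite mem_nth.
- by move=> j; case: (hd j).
- move=> j; case fj: (f j) => [b|//] _.
  move/eqP: fj; rewrite fE => /andP[/dot_nz[u hu] _].
  by exists (u *m B); [apply/DB; exists u|rewrite -dot_col].
have key (u : 'rV[F]_k) j : (u *m B) 0 j =
    if f j is Some b then d j * (u *m simplex_mx F k) 0 b else 0.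
  rewrite -dot_col; case fj: (f j) => [b|]; last by rewrite fN ?dot0r.
  by rewrite ((hd j).2 b fj) dotZr -dot_col col_simplex_mx.
move=> v; split.
  case/DB=> u ->; exists (u *m simplex_mx F k) => //.
  by apply/mem_generated_code; exists u.
case=> w /mem_generated_code[u ->] h; apply/DB; exists u.
by apply/rowP=> j; rewrite h key.
Qed.

Lemma const_weight_embeds n (D : {vspace 'rV[F]_n}) Delta :
  D != 0%VS -> (forall v, v \in D -> v != 0 -> weight v = Delta) ->
  exists k, [/\ (1 <= k)%N, (#|F| ^ (k - 1) %| Delta)%N &
             embeds (summand_code F Delta (Sim k)) D].
Proof.
move=> D0 wD; have [B [DB B0]] := vspace_basis_mx D.
exists (\dim D); have k0 : (0 < \dim D)%N by rewrite lt0n dimv_eq0.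
have wB u : u != 0 -> weight (u *m B) = Delta.
  move=> u0; apply: wD; first by apply/DB; exists u.
  by apply: contraNneq u0 => /B0 ->.
by have [] := embeds_simplex k0 DB wB; split.
Qed.

End SimplexSummand.

(** * Components of the words of weight Delta *)

Section Components.
Variable F : finFieldType.

Definition supp n (v : 'rV[F]_n) : {set 'I_n} := [set j | v 0 j != 0].

Lemma card_supp n (v : 'rV[F]_n) : #|supp v| = weight v.
Proof. by []. Qed.

Definition meets n (u v : 'rV[F]_n) : bool := supp u :&: supp v != set0.

Lemma meetsP n (u v : 'rV[F]_n) :
  reflect (exists j, u 0 j != 0 /\ v 0 j != 0) (meets u v).
Proof.
apply: (iffP (set0Pn _)) => -[j]; first by rewrite !inE => /andP[]; exists j.
by move=> [uj vj]; exists j; rewrite !inE uj.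
Qed.

Lemma meetsC n (u v : 'rV[F]_n) : meets u v = meets v u.
Proof. by rewrite /meets setIC. Qed.

Lemma suppZ n c (v : 'rV[F]_n) : c != 0 -> supp (c *: v) = supp v.
Proof.
by move=> c0; apply/setP=> j; rewrite !inE mxE mulf_eq0 (negPf c0).
Qed.

Lemma span_ind n (X : seq 'rV[F]_n) (P : pred 'rV[F]_n) :
  P 0 -> (forall u v, P u -> P v -> P (u + v)) ->
  (forall c u, P u -> P (c *: u)) -> (forall u, u \in X -> P u) ->
  forall v, v \in <<X>>%VS -> P v.
Proof.
move=> P0 PD PZ PX v /(coord_span (X := in_tuple X)) ->.
apply: (big_ind (fun v => is_true (P v))) => // i _; apply/PZ/PX.
exact: mem_nth.
Qed.

Section Fixed.
Variables (n Delta : nat) (C : {vspace 'rV[F]_n}).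
Hypotheses (Delta_gt0 : (0 < Delta)%N) (divC : divisible_code Delta C).

Definition minw (v : 'rV[F]_n) : bool := (v \in C) && (weight v == Delta).

Lemma minw_neq0 v : minw v -> v != 0.
Proof.
move=> /andP[_ /eqP wv]; apply/eqP=> v0.
by move: Delta_gt0; rewrite -wv v0 weight0.
Qed.

Lemma minwZ c v : c != 0 -> minw v -> minw (c *: v).
Proof.
move=> c0 /andP[vC wv].
by rewrite /minw rpredZ //= -card_supp suppZ // card_supp.
Qed.

Lemma weight_lt2 v : v \in C -> v != 0 -> (weight v < 2 * Delta)%N -> minw v.
Proof.
move=> vC v0 wv; rewrite /minw vC /=.
have /dvdnP[[|[|m]] h] := divC vC.
- by move: v0; rewrite (weight_eq0 h) eqxx.
- by rewrite h mul1n.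
- by move: wv; rewrite h ltn_pmul2r.
Qed.

(** Meeting supports have a union of fewer than [2 * Delta] positions, so every [c + l *: c'], being
    nonzero, has weight [Delta] by [weight_lt2]. Summing these weights over all [l], position by
    position, yields the size of the intersection. *)
Lemma minw_pair c c' : minw c -> minw c' -> meets c c' -> c \notin <[c']>%VS ->
  (forall l, minw (c + l *: c')) /\
  (#|F| * #|supp c :&: supp c'| + Delta = #|F| * Delta)%N.
Proof.
move=> /andP[cC /eqP wc] /andP[c'C /eqP wc'] cc' ncc'.
have t0 : (0 < #|supp c :&: supp c'|)%N by rewrite card_gt0.
have mw l : minw (c + l *: c').
  apply: weight_lt2; first by rewrite rpredD // rpredZ.
    apply: contraNneq ncc' => h; apply/vlineP; exists (- l).
    by apply/eqP; rewrite scaleNr -addr_eq0 h.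
  have := cardsU (supp c) (supp c'); rewrite !card_supp wc wc' => hU.
  have /subset_leq_card : supp (c + l *: c') \subset supp c :|: supp c'.
    apply/subsetP=> j; rewrite !inE !mxE -negb_and.
    apply: contra => /andP[/eqP -> /eqP ->].
    by rewrite mulr0 addr0 eqxx.
  rewrite card_supp hU; lia.
split=> //.
(* Off the support of [c'] the entry does not depend on [l]; on it exactly one [l] gives zero. The
   terms are arranged to avoid subtraction. *)
have e j : (#|[set l : F | (c 0 j + l * c' 0 j)%R != 0%R]| +
    ((c' 0%R j != 0%R) + #|F| * ((c 0%R j != 0%R) && (c' 0%R j != 0%R))) =
    #|F| * (c 0%R j != 0%R) + #|F| * (c' 0%R j != 0%R))%N.
  have [c'j|c'j] := eqVneq (c' 0 j) 0.
    rewrite andbF !muln0 !addn0.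
    have [cj|cj] := eqVneq (c 0 j) 0.
      by rewrite muln0; apply/eqP; rewrite cards_eq0; apply/eqP/setP=> l;
         rewrite !inE c'j cj mulr0 addr0 eqxx.
    by rewrite muln1 -cardsT; apply: eq_card => l;
       rewrite !inE c'j mulr0 addr0.
  have -> : [set l | c 0 j + l * c' 0 j != 0] = [set~ - c 0 j / c' 0 j].
    apply/setP=> l; rewrite !inE; congr (~~ _); rewrite addrC addr_eq0.
    by rewrite -(inj_eq (mulIf c'j) l) divfK.
  rewrite cardsC1 andbT; have := card_field_gt1 F.
  by case: (c 0 j != 0) => /=; lia.
have : (\sum_(l : F) weight (c + l *: c')%R = #|F| * Delta)%N.
  by rewrite -sum_nat_const; apply: eq_bigr => l _; have /andP[_ /eqP] := mw l.
have -> : (\sum_(l : F) weight (c + l *: c')%R =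
    \sum_(j < n) #|[set l : F | (c 0 j + l * c' 0 j)%R != 0%R]|)%N.
  under eq_bigr do rewrite weightE.
  rewrite exchange_big /=; apply: eq_bigr => j _.
  by rewrite -sum1dep_card -big_mkcond /=; apply: eq_bigl => l; rewrite !mxE.
have := @eq_bigr _ 0%N addn _ (index_enum 'I_n) xpredT _ _ (fun j _ => e j).
rewrite !big_split /= -!big_distrr /= -!weightE wc wc' => h h'.
move: h; rewrite h'.
have -> : (\sum_(j < n) ((c 0%R j != 0%R) && (c' 0%R j != 0%R)) =
    #|supp c :&: supp c'|)%N.
  rewrite -big_mkcond sum1dep_card; apply: eq_card => j.
  by rewrite !inE.
by move/addnI; rewrite addnC.
Qed.

(** If [u + v] missed the support of [u], then [v] would cancel [u] there; as both supports have
    [Delta] positions, this forces [u = - v]. *)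
Lemma minw_add u v : minw u -> minw v -> meets u v -> u \notin <[v]>%VS ->
  minw (u + v) /\ meets u (u + v).
Proof.
move=> mu mv uv nuv; have [/(_ 1) h _] := minw_pair mu mv uv nuv.
rewrite scale1r in h; split=> //; apply: contraNT nuv => /meetsP nm.
have sub : supp u \subset supp v.
  apply/subsetP=> j; rewrite !inE => uj; apply/eqP=> vj.
  by case: nm; exists j; rewrite mxE vj addr0.
have /eqP sE : supp u == supp v.
  rewrite eqEcard sub !card_supp.
  by move: mu mv => /andP[_ /eqP ->] /andP[_ /eqP ->] /=.
apply/vlineP; exists (-1); rewrite scaleN1r; apply/eqP; rewrite -addr_eq0.
apply/eqP/rowP=> j; rewrite [RHS]mxE.
have [uj|uj] := eqVneq (u 0 j) 0.
  have : j \notin supp v by rewrite -sE inE uj eqxx.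
  by rewrite inE negbK mxE uj add0r => /eqP.
by apply/eqP; apply: contra_notT nm => h'; exists j.
Qed.

(** The alternative for [c] is what splits a generating set into words of [D] and words that vanish
    on the support of [D]. *)
Definition component (D : {vspace 'rV[F]_n}) : Prop :=
  [/\ (D <= C)%VS, D != 0%VS &
      forall c, minw c -> c \in D \/
        forall v j, v \in D -> v 0 j != 0 -> c 0 j = 0].

(** Transitivity makes the words of weight [Delta] that meet [w0], together with 0, closed under
    addition, so their span contains nothing else and has constant weight. *)
Lemma transitive_component w0 : minw w0 ->
  (forall u v w, minw u -> minw v -> minw w ->
     meets u v -> meets v w -> meets u w) ->
  exists2 D, component D & forall v, v \in D -> v != 0 -> weight v = Delta.
Proof.
move=> mw0 tr.
pose X := [seq c <- enum {: 'rV[F]_n} | minw c && meets w0 c].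
pose good v := (v == 0) || (minw v && meets w0 v).
have w0w0 : meets w0 w0.
  apply/set0Pn; rewrite setIid; apply/set0Pn; rewrite -card_gt0 card_supp.
  by case/andP: mw0 => _ /eqP ->.
have goodZ c u : good u -> good (c *: u).
  have [->|c0] := eqVneq c 0; first by rewrite scale0r /good eqxx.
  case/predU1P=> [->|/andP[mu hu]]; first by rewrite scaler0 /good eqxx.
  by rewrite /good minwZ //= /meets suppZ // [_ :&: _ != _]hu orbT.
have XD v : v \in <<X>>%VS -> good v.
  apply: span_ind => //; first by rewrite /good eqxx.
    move=> u {}v gu gv.
    have [/vlineP[c ->]|nuv] := boolP (u \in <[v]>%VS).
      by rewrite -{2}[v]scale1r -scalerDl goodZ.
    case/predU1P: gu nuv => [->|/andP[mu hu] nuv]; first by rewrite mem0v.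
    case/predU1P: gv nuv => [->|/andP[mv hv] nuv].
      by rewrite addr0 /good mu hu orbT.
    have uv : meets u v by apply: (tr _ w0) => //; rewrite meetsC.
    have [muv huv] := minw_add mu mv uv nuv.
    by rewrite /good muv (tr _ u) ?orbT.
  by move=> u; rewrite mem_filter => /andP[h _]; rewrite /good h orbT.
have w0X : w0 \in <<X>>%VS.
  by apply: memv_span; rewrite mem_filter mw0 w0w0 mem_enum.
exists <<X>>%VS.
  split.
  - apply/span_subvP=> u; rewrite mem_filter => /andP[/andP[/andP[uC _] _] _].
    exact: uC.
  - apply: contraNneq (minw_neq0 mw0) => X0.
    by rewrite -memv0 -X0.
  move=> c mc; have [h|h] := boolP (meets w0 c).
    by left; apply: memv_span; rewrite mem_filter mc h mem_enum.
  right=> v j vX vj; apply/eqP; apply: contraNT h => cj.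
  have v0 : v != 0 by apply: contraNneq vj => ->; rewrite mxE.
  have := XD v vX; rewrite /good (negPf v0) /= => /andP[mv hv].
  by apply: (tr _ v) => //; apply/meetsP; exists j.
move=> v vX v0; have := XD v vX; rewrite /good (negPf v0) /=.
by case/andP=> /andP[_ /eqP].
Qed.

(** By [minw_pair], [v] shares a fraction (q - 1)/q of its support with each of [u] and [w]. If [u]
    and [w] did not meet, these two parts would be disjoint, whence 2(q - 1) <= q, impossible for q
    > 2. *)
Lemma meets_trans_q_gt2 : (2 < #|F|)%N ->
  forall u v w, minw u -> minw v -> minw w ->
     meets u v -> meets v w -> meets u w.
Proof.
move=> q2 u v w mu mv mw uv vw; apply: contraT => nuw.
have nvu : v \notin <[u]>%VS.
  apply: contra nuw => /vlineP[c vE]; move: vw; rewrite vE /meets suppZ //.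
  by apply: contraTneq (minw_neq0 mv) => c0; rewrite vE c0 scale0r eqxx.
have nvw : v \notin <[w]>%VS.
  apply: contra nuw => /vlineP[c vE]; move: uv; rewrite vE /meets suppZ //.
  by apply: contraTneq (minw_neq0 mv) => c0; rewrite vE c0 scale0r eqxx.
have [|_ e1] := minw_pair mv mu _ nvu; first by rewrite meetsC.
have [_ e2] := minw_pair mv mw vw nvw.
have : (#|supp v :&: supp u| + #|supp v :&: supp w| <= Delta)%N.
  have /andP[_ /eqP <-] := mv; rewrite -card_supp -cardsUI.
  have -> : (supp v :&: supp u) :&: (supp v :&: supp w) = set0.
    apply/eqP; rewrite -subset0; move: nuw; rewrite /meets negbK => /eqP <-.
    by apply/subsetP=> j; rewrite !in_setI => /andP[/andP[_ ->] /andP[_ ->]].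
  rewrite cards0 addn0 subset_leq_card //.
  by rewrite subUset !subsetIl.
move: e1 e2 q2; set a := #|_ :&: _|; set b := #|_ :&: _|; move: #|F| => q.
move=> e1 e2 q2 le.
have : (q * (a + b) <= q * Delta)%N by rewrite leq_mul2l le orbT.
have : (3 * Delta <= q * Delta)%N by rewrite leq_mul2r q2 orbT.
rewrite mulnDr; lia.
Qed.

End Fixed.
End Components.

(** * The binary case *)

(* Cardinals are generalized first, as [lia] fails to identify equal ones. *)
Ltac card_lia := clear; repeat (move: #|_| => ?); lia.

Section Binary.
Variable F : finFieldType.
Hypothesis q2 : #|F| = 2.

Lemma F2_neq0 (x : F) : x != 0 -> x = 1.
Proof.
move=> x0; apply/eqP/contraT => x1.
have := max_card [set 0; 1; x].
rewrite q2 -setUA cardsU1 !inE cards2 !(eq_sym _ x) (eq_sym 0).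
by rewrite x1 (negPf x0) oner_eq0.
Qed.

Lemma F2_addxx (x : F) : x + x = 0.
Proof.
have h : (1 : F) + 1 = 0.
  by rewrite -{2}(@F2_neq0 (-1)) ?subrr // oppr_eq0 oner_neq0.
by rewrite -[x]mulr1 -mulrDr h mulr0.
Qed.

Lemma F2_opp (x : F) : - x = x.
Proof. by apply/eqP; rewrite eq_sym -addr_eq0 F2_addxx. Qed.

Lemma F2_bool (x : F) : x = (x != 0)%:R.
Proof. by case: eqVneq => [->|/F2_neq0->]. Qed.

(** A word over the field with two elements is determined by its support ([indK]), so binary words
    are handled as sets. *)
Definition indicator n (S : {set 'I_n}) : 'rV[F]_n := \row_j (j \in S)%:R.

Lemma supp_ind n (S : {set 'I_n}) : supp (indicator S) = S.
Proof.
by apply/setP=> j; rewrite inE mxE; case: (j \in S); rewrite ?oner_eq0 ?eqxx.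
Qed.

Lemma indK n (v : 'rV[F]_n) : indicator (supp v) = v.
Proof. by apply/rowP=> j; rewrite mxE inE -F2_bool. Qed.

Lemma suppD n (u v : 'rV[F]_n) j :
  (j \in supp (u + v)) = (j \in supp u) (+) (j \in supp v).
Proof.
rewrite !inE mxE; have [->|/F2_neq0 ->] := eqVneq (u 0 j) 0.
  by rewrite add0r.
have [->|/F2_neq0 ->] := eqVneq (v 0 j) 0; first by rewrite addr0 oner_eq0.
by rewrite F2_addxx eqxx.
Qed.

Lemma ind_memv n (C : {vspace 'rV[F]_n}) v (S : {set 'I_n}) :
  v \in C -> supp v =i S -> indicator S \in C.
Proof. by move=> vC /setP <-; rewrite indK. Qed.

Lemma F2_line n (u v : 'rV[F]_n) : u != 0 -> (u \in <[v]>%VS) = (u == v).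
Proof.
move=> u0; apply/idP/eqP=> [/vlineP[c uE]|->]; last exact: memv_line.
rewrite uE (@F2_neq0 c) ?scale1r //.
by apply: contraNneq u0 => c0; rewrite uE c0 scale0r.
Qed.

Lemma mem_parity2 k (b j : 'I_k.+1) : b != j ->
  (delta_mx 0 b + delta_mx 0 j : 'rV[F]_k.+1) \in words (parity_check_code F k).
Proof.
move=> bj; apply/mem_parity_check_code.
under eq_bigr do rewrite mxE.
rewrite big_split /= (bigD1 b) //= big1 ?addr0; last first.
  by move=> i ni; rewrite mxE (negPf ni) andbF.
rewrite (bigD1 j) //= big1 ?addr0; last first.
  by move=> i ni; rewrite mxE (negPf ni) andbF.
by rewrite !mxE !eqxx /= F2_addxx.
Qed.

Section Fixed.
Variables (n Delta : nat) (C : {vspace 'rV[F]_n}).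
Hypotheses (Delta_gt0 : (0 < Delta)%N) (divC : divisible_code Delta C).

Lemma minw_card v : minw Delta C v -> #|supp v| = Delta.
Proof. by case/andP=> _ /eqP. Qed.

Lemma minw_capF2 u v :
  minw Delta C u -> minw Delta C v -> u != v -> meets u v ->
  (2 * #|supp u :&: supp v| = Delta)%N.
Proof.
move=> mu mv uv huv; have u0 := minw_neq0 Delta_gt0 mu.
have [|_] := minw_pair Delta_gt0 divC mu mv huv; first by rewrite F2_line.
by rewrite q2; card_lia.
Qed.

(** Boolean-valued so that [maxset] can supply a maximal system. Sizes are stated without division,
    as [Delta] is not known to be even. *)
Definition blocks (P : {set {set 'I_n}}) : bool :=
  [&& trivIset P, [forall A in P, (2 * #|A| == Delta)%N] &
      [forall A in P, forall B in P, (A != B) ==> (indicator (A :|: B) \in C)]].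

Lemma blocksP (P : {set {set 'I_n}}) : reflect
  [/\ forall A B : {set 'I_n}, A \in P -> B \in P -> A != B -> [disjoint A & B],
      forall A, A \in P -> (2 * #|A|)%N = Delta &
      forall A B, A \in P -> B \in P -> A != B -> indicator (A :|: B) \in C]
  (blocks P).
Proof.
apply: (iffP and3P) => -[h1 h2 h3]; split.
- exact/trivIsetP.
- by move=> A AP; apply/eqP; have /forall_inP := h2; apply.
- move=> A B AP BP; have /forall_inP/(_ A AP)/forall_inP/(_ B BP) := h3.
  by move/implyP.
- exact/trivIsetP.
- by apply/forall_inP=> A AP; rewrite h2.
- apply/forall_inP=> A AP; apply/forall_inP=> B BP; apply/implyP; exact: h3.
Qed.

(** [v] shares half of its support with [u] and half with [w], and these halves are disjoint; so
    they exhaust [v], and [v] cuts each of [u] and [w] into two equal parts. *)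
Lemma blocks_exist u v w : minw Delta C u -> minw Delta C v -> minw Delta C w ->
  meets u v -> meets v w -> ~~ meets u w ->
  exists2 P, blocks P & (4 <= #|P|)%N.
Proof.
move=> mu mv mw uv vw nuw.
have cu := minw_card mu; have cv := minw_card mv; have cw := minw_card mw.
have [uC _] := andP mu; have [vC _] := andP mv; have [wC _] := andP mw.
have nuv : u != v by apply: contraNneq nuw => ->.
have nvw : v != w by apply: contraNneq nuw => <-.
have euv := minw_capF2 mu mv nuv uv.
have evw := minw_capF2 mv mw nvw vw.
have dis j : (j \in supp u) && (j \in supp w) = false.
  by apply: contraNF nuw => h; apply/set0Pn; exists j; rewrite in_setI.
have vsub j : j \in supp v -> (j \in supp u) || (j \in supp w).
  have dj : (supp u :&: supp v) :&: (supp v :&: supp w) = set0.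
    apply/setP=> i; rewrite !in_setI in_set0; have := dis i.
    by case: (_ \in _); case: (_ \in _); case: (_ \in _).
  have := cardsUI (supp u :&: supp v) (supp v :&: supp w).
  rewrite dj cards0 addn0 => e.
  have /eqP E : (supp u :&: supp v) :|: (supp v :&: supp w) == supp v.
    rewrite eqEcard e cv subUset subsetIr subsetIl /=.
    by move: euv evw; card_lia.
  rewrite -{1}E !inE; by case: (_ != _) => //=; case: (_ != _); case: (_ != _).
(* The pairwise unions of these four sets are the supports of [u], [w], [v], [v + w], [u + v] and
   [u + v + w]. *)
pose A1 := supp u :&: supp v; pose A2 := supp u :\: supp v.
pose A3 := supp w :&: supp v; pose A4 := supp w :\: supp v.
have c1 : (2 * #|A1|)%N = Delta by [].
have c2 : (2 * #|A2|)%N = Delta.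
  by have := cardsID (supp v) (supp u); move: c1; rewrite -/A1 -/A2 cu; card_lia.
have c3 : (2 * #|A3|)%N = Delta by rewrite /A3 setIC.
have c4 : (2 * #|A4|)%N = Delta.
  by have := cardsID (supp v) (supp w); move: c3; rewrite -/A3 -/A4 cw; card_lia.
have dj (A B : {set 'I_n}) :
    (forall j, (j \in A) && (j \in B) = false) -> [disjoint A & B].
  by move=> h; apply/pred0P=> j; apply: h.
pose s := [:: A1; A2; A3; A4].
have d12 : [disjoint A1 & A2].
  by apply: dj => j; rewrite !inE; do 2 case: (_ != _).
have d34 : [disjoint A3 & A4].
  by apply: dj => j; rewrite !inE; do 2 case: (_ != _).
have dd (A B : {set 'I_n}) :
    A \subset supp u -> B \subset supp w -> [disjoint A & B].
  move=> Au Bw; apply: dj => j; apply/negP=> /andP[/(subsetP Au) h].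
  by move/(subsetP Bw) => h'; have := dis j; rewrite h h'.
have d13 : [disjoint A1 & A3] by apply: dd; exact: subsetIl.
have d14 : [disjoint A1 & A4] by apply: dd; [exact: subsetIl|exact: subsetDl].
have d23 : [disjoint A2 & A3] by apply: dd; [exact: subsetDl|exact: subsetIl].
have d24 : [disjoint A2 & A4] by apply: dd; exact: subsetDl.
have neq (A B : {set 'I_n}) :
    (2 * #|A|)%N = Delta -> [disjoint A & B] -> A != B.
  move=> cA dAB; apply/eqP=> AB; move: dAB; rewrite AB -setI_eq0 setIid -AB.
  by rewrite -cards_eq0 => /eqP; move: cA Delta_gt0; card_lia.
have i12 : indicator (A1 :|: A2) \in C.
  by apply: (ind_memv uC) => j; rewrite !inE; do 2 case: (_ != _).
have i34 : indicator (A3 :|: A4) \in C.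
  by apply: (ind_memv wC) => j; rewrite !inE; do 2 case: (_ != _).
have bool_mem x (S : {set 'I_n}) : x \in C ->
    (forall j, (j \in supp u) && (j \in supp w) = false ->
    ((j \in supp v) ==> ((j \in supp u) || (j \in supp w))) ->
    (j \in supp x) = (j \in S)) -> indicator S \in C.
  by move=> xC h; apply: (ind_memv xC) => j; apply: h => //; apply/implyP/vsub.
have i13 : indicator (A1 :|: A3) \in C.
  apply: (bool_mem _ _ vC) => j; rewrite in_setU !in_setI.
  by case: (_ \in supp u); case: (_ \in supp w); case: (_ \in supp v).
have i14 : indicator (A1 :|: A4) \in C.
  apply: (bool_mem _ _ (rpredD vC wC)) => j; rewrite suppD in_setU in_setI in_setD.
  by case: (_ \in supp u); case: (_ \in supp w); case: (_ \in supp v).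
have i23 : indicator (A2 :|: A3) \in C.
  apply: (bool_mem _ _ (rpredD uC vC)) => j; rewrite suppD in_setU in_setI in_setD.
  by case: (_ \in supp u); case: (_ \in supp w); case: (_ \in supp v).
have i24 : indicator (A2 :|: A4) \in C.
  apply: (bool_mem _ _ (rpredD (rpredD uC vC) wC)) => j.
  rewrite !suppD in_setU !in_setD.
  by case: (_ \in supp u); case: (_ \in supp w); case: (_ \in supp v).
exists [set A in s].
  apply/blocksP; split.
  - move=> A B; rewrite !in_set => /[swap]; rewrite !inE.
    case/or4P=> /eqP ->; case/or4P=> /eqP ->; rewrite ?eqxx // => _;
      by [|rewrite disjoint_sym].
  - by move=> A; rewrite !inE => /or4P[] /eqP ->.
  - move=> A B; rewrite !in_set => /[swap]; rewrite !inE.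
    case/or4P=> /eqP ->; case/or4P=> /eqP ->; rewrite ?eqxx // => _;
      by [|rewrite setUC].
rewrite cardsE; have /card_uniqP -> // : uniq s.
by rewrite /= !inE !negb_or !neq.
Qed.

Lemma trivIset_capE P (W : {set 'I_n}) : trivIset P ->
  #|W :&: cover P| = (\sum_(A in P) #|W :&: A|)%N.
Proof.
move=> tP.
have e (A : {set 'I_n}) : #|W :&: A| = (\sum_(x in A) (x \in W))%N.
  by rewrite -big_mkcondr sum1dep_card; apply: eq_card => x; rewrite !inE andbC.
by rewrite e (big_trivIset _ tP); apply: eq_bigr => A _; rewrite e.
Qed.

(** Compare [w] with the unions of two blocks: if it is none of them, its intersections with any two
    blocks have sizes adding up to 0 or to half of [Delta]. Either one block lies in [w] and the
    others are missed, which contradicts maximality, or all these sizes are a quarter of [Delta],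
    and the bound [Delta] on their total leaves at most four blocks. *)
Lemma blocks_minw P w : maxset blocks P -> (4 <= #|P|)%N -> minw Delta C w ->
  supp w :&: cover P != set0 ->
  (exists A B, [/\ A \in P, B \in P, A != B & w = indicator (A :|: B)]) \/
  (#|P| = 4 /\ supp w \subset cover P).
Proof.
move=> maxP P4 mw wP; have bP := maxsetp maxP.
have [dP cP iP] := blocksP _ bP; have /and3P[tP _ _] := bP.
have [h|npair] := boolP [exists A in P, [exists B in P,
    (A != B) && (w == indicator (A :|: B))]].
  have /exists_inP[A AP /exists_inP[B BP /andP[AB /eqP wAB]]] := h.
  by left; exists A, B.
right.
have cw := minw_card mw; have [wC _] := andP mw.
have pair A B : A \in P -> B \in P -> A != B ->
    (2 * (#|supp w :&: A| + #|supp w :&: B|) = 0 \/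
     2 * (#|supp w :&: A| + #|supp w :&: B|) = Delta)%N.
  move=> AP BP AB.
  have <- : #|supp w :&: (A :|: B)| = (#|supp w :&: A| + #|supp w :&: B|)%N.
    rewrite -cardsUI -setIUr; have /setP h : A :&: B = set0.
      by apply/eqP; rewrite setI_eq0 dP.
    rewrite [X in (_ + #|pred_of_set X|)%N](_ : _ = set0) ?cards0 ?addn0 //.
    apply/setP=> j; have := h j; rewrite !in_setI in_set0.
    by case: (_ \in supp w).
  have mAB : minw Delta C (indicator (A :|: B)).
    rewrite /minw iP //= -card_supp supp_ind.
    have := cardsUI A B.
    have -> : A :&: B = set0 by apply/eqP; rewrite setI_eq0 dP.
    by rewrite cards0; have := cP A AP; have := cP B BP; card_lia.
  have [hm|] := boolP (meets w (indicator (A :|: B))); last first.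
    by rewrite /meets supp_ind negbK => /eqP ->; rewrite cards0; left.
  right; rewrite -{1}(supp_ind (A :|: B)) minw_capF2 //.
  apply: contraNneq npair => wE; apply/exists_inP; exists A => //.
  by apply/exists_inP; exists B; rewrite // AB -wE eqxx.
have [j] := set0Pn _ wP; rewrite in_setI => /andP[jw /bigcupP[E EP jE]].
have xE : (0 < #|supp w :&: E|)%N.
  by apply/card_gt0P; exists j; rewrite in_setI jw.
have pE A : A \in P -> A != E -> (2 * (#|supp w :&: A| + #|supp w :&: E|) = Delta)%N.
  by move=> AP AE; case: (pair A E AP EP AE) => //; move: xE; card_lia.
have /card_gt1P[A [B [AP BP AB]]] : (1 < #|P :\ E|)%N.
  by have := cardsD1 E P; rewrite EP; move: P4; card_lia.
move: AP BP; rewrite !in_setD1 => /andP[AE AP] /andP[BE BP].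
have [hA hB] := (pE A AP AE, pE B BP BE).
have [y0|y4] := pair A B AP BP AB.
  have x0 A' : A' \in P -> A' != E -> #|supp w :&: A'| = 0%N.
    by move=> A'P A'E; have := pE A' A'P A'E; move: hA y0; card_lia.
  have xE2 : (2 * #|supp w :&: E|)%N = Delta by move: hA y0; card_lia.
  have EW : E \subset supp w.
    apply/setIidPr/eqP; rewrite eqEcard subsetIr.
    by have := cP E EP; move: xE2; card_lia.
  (* [N] is half of [w] and misses all blocks; it is a further block, against maximality. *)
  pose N := supp w :\: E.
  have cN : (2 * #|N|)%N = Delta 
    by have := cardsID E (supp w); move: xE2; rewrite -/N cw; card_lia.
  have dN A' : A' \in P -> [disjoint N & A'].
    move=> A'P; rewrite -setI_eq0; apply/eqP/setP=> i; rewrite in_set0 in_setI.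
    rewrite in_setD; have [->|A'E] := eqVneq A' E.
      by case: (_ \in E); rewrite ?andbF.
    have /eqP := x0 A' A'P A'E; rewrite cards_eq0 => /eqP/setP/(_ i).
    rewrite in_setI in_set0; case: (i \in A'); rewrite ?andbF // andbT => ->.
    by rewrite andbF.
  have NP : N \notin P.
    apply/negP=> NP; have := dN N NP; rewrite -setI_eq0 setIid -cards_eq0.
    by move/eqP; move: cN Delta_gt0; card_lia.
  have iN A' : A' \in P -> indicator (N :|: A') \in C.
    move=> A'P; have [->|A'E] := eqVneq A' E.
      apply: (ind_memv wC) => i; rewrite in_setU in_setD.
      by case: (i \in E) (subsetP EW i) => [h|_] /=; rewrite ?h ?orbF.
    (* Adding the word of [A' :|: E] to [w] cancels [E] and brings in [A']. *)
    apply: (ind_memv (rpredD wC (iP A' E A'P EP A'E))) => i.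
    rewrite suppD supp_ind !in_setU in_setD.
    have : (i \in A') && (i \in E) = false.
      by apply: contraTF (dP _ _ A'P EP A'E) => h; apply/pred0Pn; exists i.
    have : (i \in N) && (i \in A') = false.
      by apply: contraTF (dN A' A'P) => h; apply/pred0Pn; exists i.
    have : (i \in E) ==> (i \in supp w) by apply/implyP/(subsetP EW).
    rewrite in_setD.
    by case: (i \in E); case: (i \in A'); case: (i \in supp w).
  have bN : blocks (N |: P).
    apply/blocksP; split.
    - move=> A' B'; rewrite !in_setU1 => /predU1P[->|A'P] /predU1P[->|B'P] ne //.
      + by rewrite eqxx in ne.
      + exact: dN.
      + by rewrite disjoint_sym; apply: dN.
      + exact: dP.
    - by move=> A'; rewrite in_setU1 => /predU1P[->//|]; apply: cP.
    - move=> A' B'; rewrite !in_setU1 => /predU1P[->|A'P] /predU1P[->|B'P] ne //.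
      + by rewrite eqxx in ne.
      + exact: iN.
      + by rewrite setUC; apply: iN.
      + exact: iP.
  have := maxsetsup maxP bN (subsetUr _ _) => /setP/(_ N).
  by rewrite setU11 (negPf NP).
have x4 A' : A' \in P -> (4 * #|supp w :&: A'| = Delta)%N.
  move=> A'P; have [->|A'E] := eqVneq A' E; first by move: hA hB y4; card_lia.
  by have := pE A' A'P A'E; move: hA hB y4; card_lia.
have := trivIset_capE (supp w) tP.
have /subset_leq_card : supp w :&: cover P \subset supp w by apply: subsetIl.
rewrite cw => le e.
have e4 : (4 * #|supp w :&: cover P| = #|P| * Delta)%N.
  rewrite e big_distrr /= -sum_nat_const; apply: eq_bigr => A' A'P; exact: x4.
have P4' : #|P| = 4.
  apply/eqP; rewrite eqn_leq P4 andbT -(leq_pmul2r Delta_gt0) -e4.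
  by move: le; card_lia.
split=> //; apply/setIidPl/eqP; rewrite eqEcard subsetIl cw /=.
by move: e4; rewrite P4'; card_lia.
Qed.

End Fixed.
End Binary.

(** * Components obtained from maximal block systems *)

Section BinaryComponents.
Variable F : finFieldType.
Hypothesis q2 : #|F| = 2.
Variables (n Delta : nat) (C : {vspace 'rV[F]_n}).
Hypotheses (Delta_gt0 : (0 < Delta)%N) (divC : divisible_code Delta C).

Local Notation ind := (@indicator F n).
Local Notation blocks := (@blocks F n Delta C).

Lemma ind_disjointU (A B : {set 'I_n}) :
  [disjoint A & B] -> ind (A :|: B) = ind A + ind B.
Proof.
move=> dAB; rewrite -[RHS](indK q2); congr indicator; apply/setP=> j.
rewrite suppD // !supp_ind in_setU; have := disjointFr dAB (x := j).
by case: (j \in A) => //= ->.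
Qed.

Lemma blocks_subC P A B : blocks P -> A \in P -> B \in P -> ind A - ind B \in C.
Proof.
case/blocksP=> dP _ iP AP BP.
have [->|AB] := eqVneq A B; first by rewrite subrr mem0v.
have -> : - ind B = ind B by apply/rowP=> j; rewrite !mxE F2_opp.
by rewrite -ind_disjointU ?iP ?dP.
Qed.

Lemma blocks_minw_out P (w v : 'rV[F]_n) j :
  minw Delta C w -> supp w :&: cover P = set0 ->
  supp v \subset cover P -> v 0 j != 0 -> w 0 j = 0.
Proof.
move=> mw wP /subsetP vP vj; apply/eqP; apply: contraT => wj.
have : j \in supp w :&: cover P by rewrite in_setI vP !inE ?wj.
by rewrite wP in_set0.
Qed.

Lemma component_neq0 (D : {vspace 'rV[F]_n}) w :
  minw Delta C w -> w \in D -> D != 0%VS.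
Proof.
move=> mw wD; apply: contraNneq (minw_neq0 Delta_gt0 mw) => D0.
by rewrite -memv0 -D0.
Qed.

(** With at least five blocks [blocks_minw] leaves only unions of two blocks, so [D] is taken to be
    all unions of an even number of blocks: a parity check code with each position repeated over a
    block. *)
Lemma parity_check_component P : maxset blocks P -> (5 <= #|P|)%N ->
  exists2 D, component Delta C D &
    embeds (summand_code F Delta (PC #|P|.-1)) D.
Proof.
move=> maxP P5; have bP := maxsetp maxP.
have [dP cP iP] := blocksP _ _ _ bP.
have P0 : #|P| = #|P|.-1.+1 by rewrite prednK // (leq_trans _ P5).
set k := #|P|.-1 in P0 *.
pose e (b : 'I_k.+1) : {set 'I_n} := enum_val (cast_ord (esym P0) b).
have eP b : e b \in P by apply: enum_valP.
have eI : injective e by move=> b b' /enum_val_inj/cast_ord_inj.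
have eS A : A \in P -> exists b, A = e b.
  move=> AP; exists (cast_ord P0 (enum_rank_in AP A)).
  by rewrite /e cast_ordK enum_rankK_in.
pose f j := [pick b | j \in e b].
have fE j b : (f j == Some b) = (j \in e b).
  rewrite /f; case: pickP => [b' jb'|nj]; last by rewrite nj.
  apply/eqP/idP=> [[<-]//|jb]; congr Some; apply: eI; apply: contraTeq jb => ne.
  by rewrite (disjointFr (dP _ _ (eP b') (eP b) ne) jb').
pose M : 'M[F]_(k.+1, n) := \matrix_b ind (e b).
have ME (w : 'rV[F]_k.+1) j : (w *m M) 0 j = if f j is Some b then w 0 b else 0.
  rewrite mxE; case fj: (f j) => [b|].
    move/eqP: fj; rewrite fE => jb; rewrite (bigD1 b) //= big1 ?addr0.
      by rewrite !mxE jb mulr1.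
    move=> b' ne; rewrite !mxE -fE; have /eqP -> : f j == Some b by rewrite fE.
    by rewrite (inj_eq (@Some_inj _)) eq_sym (negPf ne) mulr0.
  by rewrite big1 // => b _; rewrite !mxE -fE fj mulr0.
pose D := (linfun (mulmxr M : 'rV_k.+1 -> 'rV_n) @:
            words (parity_check_code F k))%VS.
have DE v : v \in D <-> exists2 w, w \in words (parity_check_code F k) & v = w *m M.
  split; first by case/memv_imgP=> w wE ->; exists w; rewrite // lfunE.
  by case=> w wE ->; apply/memv_imgP; exists w; rewrite // lfunE.
have DP v : v \in D -> supp v \subset cover P.
  case/DE=> w _ ->; apply/subsetP=> j; rewrite inE ME.
  case fj: (f j) => [b|]; last by rewrite eqxx.
  by move=> _; move/eqP: fj; rewrite fE => jb; apply/bigcupP; exists (e b).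
have pairD A B : A \in P -> B \in P -> A != B -> ind (A :|: B) \in D.
  move=> /eS[b ->] /eS[b' ->] ne; apply/DE.
  exists (delta_mx 0 b + delta_mx 0 b').
    by apply: mem_parity2 => //; apply: contraNneq ne => ->.
  by rewrite ind_disjointU ?dP // mulmxDl -!rowE !rowK.
have [A [B [AP BP AB]]] : exists A B, [/\ A \in P, B \in P & A != B].
  by have /card_gt1P := leq_trans (isT : 2 <= 5)%N P5.
have mAB : minw Delta C (ind (A :|: B)).
  rewrite /minw iP //= -card_supp supp_ind.
  have := cardsUI A B; have /eqP -> : A :&: B == set0 by rewrite setI_eq0 dP.
  by rewrite cards0; move: (cP A AP) (cP B BP); card_lia.
exists D.
  split.
  - apply/subvP=> v /DE[w /mem_parity_check_code w0 ->].
    (* Since the entries of [w] sum to 0, the fixed word [ind (e ord0)] may be subtracted in every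
       term; the differences lie in [C]. *)
    have -> : w *m M = \sum_b w 0 b *: (ind (e b) - ind (e ord0)).
      under eq_bigr do rewrite scalerBr.
      rewrite sumrB -scaler_suml w0 scale0r subr0 mulmx_sum_row.
      by apply: eq_bigr => b _; rewrite rowK.
    by apply: rpred_sum => b _; apply: rpredZ; apply: (blocks_subC bP).
  - exact: (component_neq0 mAB (pairD _ _ AP BP AB)).
  move=> c mc; have [cPz|cPz] := eqVneq (supp c :&: cover P) set0.
    by right=> v j vD; apply: (blocks_minw_out mc cPz (DP v vD)).
  left; have P4 := ltnW P5.
  case: (blocks_minw q2 Delta_gt0 divC maxP P4 mc cPz).
    by case=> A' [B' [A'P B'P A'B' ->]]; apply: pairD.
  by case=> P4'; rewrite P4' in P5.
have cPe b : #|e b| = (Delta %/ 2)%N by rewrite -(cP _ (eP b)) mulKn.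
apply: (@embeds_repetition F _ (parity_check_code F k) n D f (fun=> 1)).
- move=> b; rewrite -(cPe b); apply: eq_card => j.
  by rewrite inE fE.
- by move=> j; rewrite oner_neq0.
- move=> j; case fj: (f j) => [b|//] _; move/eqP: fj; rewrite fE => jb.
  have [A' A'P ne] : exists2 A', A' \in P & e b != A'.
    have [->|ne] := eqVneq (e b) A; first by exists B.
    by exists A.
  exists (ind (e b :|: A')); first exact: pairD.
  by rewrite mxE in_setU jb oner_neq0.
move=> v; split.
  case/DE=> w wE ->; exists w => // j; rewrite ME; case: (f j) => // b.
  by rewrite mul1r.
case=> w wE h; apply/DE; exists w => //; apply/rowP=> j; rewrite h ME.
by case: (f j) => // b; rewrite mul1r.
Qed.

Lemma vspace_of_closed (Q : pred 'rV[F]_n) :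
  Q 0 -> (forall u v, Q u -> Q v -> Q (u + v)) ->
  (forall c u, Q u -> Q (c *: u)) ->
  exists D : {vspace 'rV[F]_n}, forall v, (v \in D) = Q v.
Proof.
move=> Q0 QD QZ; exists <<[seq v <- enum {: 'rV[F]_n} | Q v]>>%VS => v.
apply/idP/idP=> [|Qv].
  by apply: span_ind => // u; rewrite mem_filter => /andP[].
by apply: memv_span; rewrite mem_filter Qv mem_enum memvf.
Qed.

(** [D] consists of all words of [C] inside the union [U] of the blocks, [D'] of those that vanish
    at a chosen position. [D'] has constant weight, so all nonzero vectors occur equally often as
    columns of its generator matrix; since [U] has [2 * Delta] positions, the zero vector occurs as
    often within [U]. Adding the all-one word of [U] then gives a repeated Reed-Muller code, of
    dimension one more than [D']. *)
Lemma reed_muller_component P : maxset blocks P -> #|P| = 4 ->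
  exists k D, [/\ (3 <= k)%N, (2 ^ (k - 2) %| Delta)%N, component Delta C D &
    embeds (summand_code F Delta (RM k)) D].
Proof.
move=> maxP P4; have bP := maxsetp maxP.
have [dP cP iP] := blocksP _ _ _ bP; have /and3P[tP _ _] := bP.
set U := cover P.
have cU : #|U| = (2 * Delta)%N.
  apply/eqP; rewrite -(@eqn_pmul2l 2) //; move: tP; rewrite /trivIset => /eqP <-.
  rewrite big_distrr /= (eq_bigr (fun=> Delta)) => [|A AP]; last exact: cP.
  by rewrite sum_nat_const P4 mulnA.
have [A0 A0P] : exists A0, A0 \in P by apply/card_gt0P; rewrite P4.
have UC : ind U \in C.
  (* There are four blocks, so the subtracted copies of [ind A0] add up to zero. *)
  have -> : ind U = \sum_(A in P) (ind A - ind A0).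
    rewrite sumrB sumr_const P4.
    have -> : ind A0 *+ 4 = 0.
      by rewrite (mulrnA _ 2 2) mulr2n; apply/rowP=> j; rewrite !mxE F2_addxx.
    rewrite subr0; apply/rowP=> j; rewrite mxE summxE.
    have [/bigcupP[A AP jA]|nj] := boolP (j \in U).
      rewrite (bigD1 A) //= mxE jA big1 ?addr0 // => B /andP[BP BA].
      by rewrite mxE (disjointFl (dP _ _ BP AP BA) jA).
    rewrite big1 // => A AP; rewrite mxE; case jA: (j \in A) => //.
    by case/bigcupP: nj; exists A.
  by apply: rpred_sum => A AP; apply: (blocks_subC bP).
have [i0 i0A0] : exists i0, i0 \in A0.
  by apply/card_gt0P; move: (cP _ A0P) Delta_gt0; card_lia.
have i0U : i0 \in U by apply/bigcupP; exists A0.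
have subUD (u v : 'rV[F]_n) :
    supp u \subset U -> supp v \subset U -> supp (u + v) \subset U.
  move=> /subsetP uU /subsetP vU; apply/subsetP=> j; rewrite (suppD q2).
  by case uj: (j \in supp u); [rewrite uU|rewrite addFb => /vU].
have subUZ (c : F) (u : 'rV[F]_n) : supp u \subset U -> supp (c *: u) \subset U.
  move=> uU; have [->|c0] := eqVneq c 0; last by rewrite suppZ.
  by apply/subsetP=> j; rewrite inE scale0r mxE eqxx.
have subU0 : supp (0 : 'rV[F]_n) \subset U.
  by apply/subsetP=> j; rewrite inE mxE eqxx.
have [D DE] : exists D : {vspace 'rV[F]_n},
    forall v, (v \in D) = (v \in C) && (supp v \subset U).
  apply: vspace_of_closed; first by rewrite mem0v.
    by move=> u v /andP[uC uU] /andP[vC vU]; rewrite rpredD // subUD.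
  by move=> c u /andP[uC uU]; rewrite rpredZ // subUZ.
have [D' D'E] : exists D' : {vspace 'rV[F]_n},
    forall v, (v \in D') = (v \in D) && (v 0 i0 == 0).
  apply: vspace_of_closed; first by rewrite mem0v mxE eqxx.
    move=> u v /andP[uC /eqP uU] /andP[vC /eqP vU].
    by rewrite rpredD // mxE uU vU addr0 eqxx.
  by move=> c u /andP[uC /eqP uU]; rewrite rpredZ // mxE uU mulr0 eqxx.
have wD' v : v \in D' -> v != 0 -> weight v = Delta.
  rewrite D'E DE => /andP[/andP[vC vU] /eqP v0] vn.
  have /andP[_ /eqP //] : minw Delta C v.
  apply: weight_lt2 => //; rewrite -cU -card_supp; apply: proper_card.
  rewrite properE vU; apply/subsetPn; exists i0 => //.
  by rewrite inE v0 eqxx.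
have UD : ind U \in D by rewrite DE UC supp_ind subxx.
have pairD A B : A \in P -> B \in P -> A != B -> ind (A :|: B) \in D.
  move=> AP BP AB; rewrite DE iP //= supp_ind subUset.
  by apply/andP; split; apply: bigcup_sup.
have [B [BDB BD0]] := vspace_basis_mx D'.
set k := \dim D' in B BDB BD0 *.
have wB u : u != 0 -> weight (u *m B) = Delta.
  move=> u0; apply: wD'; first by apply/BDB; exists u.
  by apply: contraNneq u0 => /BD0 ->.
(* The unions [A1 :|: A2] and [A2 :|: A3] avoid [A0], which contains [i0]; they give two distinct
   nonzero words of [D'], so the Reed-Muller dimension [k.+1] is at least 3. *)
have k2 : (2 <= k)%N.
  have /card_gt2P[A1 [A2 [A3 [[A1P A2P A3P] [n12 n23 n31]]]]] : (2 < #|P :\ A0|)%N.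
    by have := cardsD1 A0 P; rewrite A0P P4; card_lia.
  move: A1P A2P A3P; rewrite !in_setD1.
  move=> /andP[A1n A1P] /andP[A2n A2P] /andP[A3n A3P].
  have mem' A B' : A \in P -> B' \in P -> A != B' -> A != A0 -> B' != A0 ->
      ind (A :|: B') \in D'.
    move=> AP BP AB AN BN; rewrite D'E pairD //= mxE in_setU.
    by rewrite (disjointFl (dP _ _ AP A0P AN) i0A0)
               (disjointFl (dP _ _ BP A0P BN) i0A0).
  have [j jA3] : exists j, j \in A3.
    by apply/card_gt0P; move: (cP _ A3P) Delta_gt0; card_lia.
  have [j' j'A2] : exists j, j \in A2.
    by apply/card_gt0P; move: (cP _ A2P) Delta_gt0; card_lia.
  have x0 : ind (A1 :|: A2) != 0.
    apply/eqP=> /rowP/(_ j')/eqP; rewrite !mxE in_setU j'A2 orbT.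
    by rewrite oner_eq0.
  rewrite ltnNge; apply/negP=> k1.
  have /eqP DL : <[ind (A1 :|: A2)]>%VS == D'.
    by rewrite eqEdim -memvE mem' // dim_vline x0 -/k k1.
  have : ind (A2 :|: A3) \in D' by apply: mem'.
  rewrite -DL F2_line //; last first.
    apply/eqP=> /rowP/(_ j)/eqP; rewrite !mxE in_setU jA3 orbT.
    by rewrite oner_eq0.
  move/eqP/rowP/(_ j)/eqP; rewrite !mxE !in_setU jA3 orbT.
  rewrite (disjointFl (dP _ _ A2P A3P n23) jA3).
  by rewrite (disjointFr (dP _ _ A3P A1P n31) jA3) oner_eq0.
have k0 : (0 < k)%N by apply: leq_trans k2.
have colU j : col j B != 0 -> j \in U.
  move/dot_nz=> [u]; rewrite dot_col => h.
  have : u *m B \in D' by apply/BDB; exists u.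
  by rewrite D'E DE -andbA => /and3P[_ /subsetP + _]; apply; rewrite inE.
pose m := (Delta %/ 2 ^ (k - 1))%N.
(* Over two elements a line has a single nonzero vector, so counting columns on the line of [x] is
   counting columns equal to [x]; nonzero columns lie in [U]. *)
have cx (x : 'cV[F]_k) : x != 0 ->
    Delta = (#|[set j | (j \in U) && (col j B == x)]| * 2 ^ (k - 1))%N.
  move=> x0; have := const_weight_columns wB x0; rewrite q2 subn1 => {1}->.
  congr (_ * _)%N; apply: eq_card => j; rewrite !inE.
  have [h|h] := eqVneq (col j B) 0.
    by rewrite h eq_sym (negPf x0) andbF.
  rewrite colU //=; apply/vlineP/eqP=> [[c hc]|->]; last first.
    by exists 1; rewrite scale1r.
  rewrite hc (F2_neq0 q2 (x := c)) ?scale1r //.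
  by apply: contraNneq h => c0; rewrite hc c0 scale0r.
have [x1 x1n] : exists x : 'cV[F]_k, x != 0.
  exists (const_mx 1); apply/eqP=> /colP/(_ (Ordinal k0))/eqP.
  by rewrite !mxE oner_eq0.
have dvd : (2 ^ (k - 1) %| Delta)%N by rewrite (cx _ x1n) dvdn_mull.
have Dm : Delta = (m * 2 ^ (k - 1))%N by rewrite divnK.
have cm (x : 'cV[F]_k) : #|[set j | (j \in U) && (col j B == x)]| = m.
  have nz (y : 'cV[F]_k) : y != 0 -> #|[set j | (j \in U) && (col j B == y)]| = m.
    move=> y0; apply/eqP; rewrite -(@eqn_pmul2r (2 ^ (k - 1))) ?expn_gt0 //.
    by rewrite -cx // -Dm.
  (* The number of zero columns in [U] is 2 Delta - (2 ^ k - 1) m = m. *)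
  have [->|] := eqVneq x 0; last exact: nz.
  have : #|U| = (\sum_(y : 'cV[F]_k) #|[set j | (j \in U) && (col j B == y)]|)%N.
    rewrite -sum1_card (partition_big (fun j => col j B) xpredT) //=.
    by apply: eq_bigr => y _; rewrite sum1dep_card.
  rewrite (bigD1 0) //= (eq_bigr (fun=> m)); last by move=> y; apply: nz.
  rewrite sum_nat_const cardC1 card_mx muln1 q2 cU {1}Dm.
  have -> : (2 ^ k = 2 * 2 ^ (k - 1))%N by rewrite -expnS subn1 prednK.
  have : (0 < 2 ^ (k - 1))%N by rewrite expn_gt0.
  case: (2 ^ (k - 1))%N => // K _; clear; move: #|_| => x; nia.
exists k.+1, D; split.
- by [].
- by rewrite -[(k.+1 - 2)%N]/(k - 1)%N.
- split.
  + by apply/subvP=> v; rewrite DE => /andP[].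
  + apply/eqP=> D0; move: UD; rewrite D0 memv0 => /eqP/rowP/(_ i0)/eqP.
    by rewrite !mxE i0U oner_eq0.
  move=> c mc; have [cPz|cPz] := eqVneq (supp c :&: cover P) set0.
    right=> v j; rewrite DE => /andP[_ vU]; exact: (blocks_minw_out mc cPz vU).
  left; have P4' : (4 <= #|P|)%N by rewrite P4.
  case: (blocks_minw q2 Delta_gt0 divC maxP P4' mc cPz).
    by case=> A' [B' [A'P B'P A'B' ->]]; apply: pairD.
  by case=> _ cU'; rewrite DE cU' andbT; case/andP: mc.
(* Inside [U] a zero column stands for the evaluation point 0; outside [U] it is a zero position. *)
pose f j : option 'I_(#|{: 'cV[F]_k}|) :=
  if j \in U then Some (enum_rank (col j B)) else None.
apply: (@embeds_repetition F _ (reed_muller_code F k.+1) n D f (fun=> 1)).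
- move=> b; rewrite -[RHS](cm (enum_val b)); apply: eq_card => j; rewrite !inE /f.
  case: (j \in U) => //=; rewrite (inj_eq (@Some_inj _)).
  by rewrite -(inj_eq enum_val_inj) enum_rankK.
- by move=> j; rewrite oner_neq0.
- move=> j; rewrite /f; case: ifP => // jU _; exists (ind U) => //.
  by rewrite mxE jU oner_neq0.
have key (u : 'rV[F]_k) (s : 'M[F]_1) j : (u *m B + s 0 0 *: ind U) 0 j =
    if f j is Some b then 1 * (row_mx u s *m reed_muller_mx F k.+1) 0 b else 0.
  rewrite /f; have [jU|nj] := boolP (j \in U).
    have -> : (u *m B + s 0 0 *: ind U) 0 j = dot u (col j B) + s 0 0.
      by rewrite dot_col [LHS]mxE; congr (_ + _); rewrite !mxE jU mulr1.
    rewrite mul1r mul_row_col mxE; congr (_ + _).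
      by rewrite dotE mxE; apply: eq_bigr => i _; rewrite [in RHS]mxE enum_rankK.
    by rewrite mxE big_ord1 mxE mulr1.
  rewrite !mxE (negPf nj) mulr0 addr0.
  have c0 : col j B = 0 by apply/eqP; apply: contraNT nj; apply: colU.
  by have := dot_col u B j; rewrite c0 dot0r mxE.
move=> v; split.
  (* Clearing position [i0] with a multiple of the all-one word of [U] lands in [D']; the multiple
     becomes the coefficient of the all-one row. *)
  move=> vD; have : v - v 0 i0 *: ind U \in D'.
    by rewrite D'E rpredB ?rpredZ //= !mxE i0U mulr1 subrr.
  move/BDB=> [u uE]; exists (row_mx u (v 0 i0)%:M *m reed_muller_mx F k.+1).
    by apply/mem_generated_code; eexists.
  move=> j; rewrite -key -uE.
  by rewrite [(_%:M : 'M_1) 0 0]mxE eqxx mulr1n subrK.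
case=> w /mem_generated_code[us ->] h.
have -> : v = lsubmx us *m B + (rsubmx us : 'M_1) 0 0 *: ind U.
  by apply/rowP=> j; rewrite h key hsubmxK.
rewrite rpredD ?rpredZ //.
have : lsubmx us *m B \in D' by apply/BDB; eexists.
by rewrite D'E => /andP[].
Qed.

End BinaryComponents.

(** * Existence *)

Section Existence.
Variable F : finFieldType.
Variables (Delta a : nat).
Hypothesis Delta_gt0 : (0 < Delta)%N.
Hypothesis ha_max : forall b : nat, (#|F| ^ b %| Delta)%N -> (b <= a)%N.

(** If meeting is transitive, a simplex component arises; otherwise q = 2, and a maximal block
    system extending the one from a failing triple has exactly four blocks (Reed-Muller) or more
    (parity check). The bounds by [a] in [admissible] come from powers of q dividing [Delta], by
    [ha_max]. *)
Lemma component_exists n (C : {vspace 'rV[F]_n}) w0 :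
  divisible_code Delta C -> minw Delta C w0 ->
  exists t D, [/\ admissible #|F| a t, component Delta C D &
                  embeds (summand_code F Delta t) D].
Proof.
move=> divC mw0.
have trans_case : (forall u v w, minw Delta C u -> minw Delta C v ->
    minw Delta C w -> meets u v -> meets v w -> meets u w) ->
    exists t D, [/\ admissible #|F| a t, component Delta C D &
                  embeds (summand_code F Delta t) D].
  move=> tr; have [D cD wD] := transitive_component Delta_gt0 divC mw0 tr.
  have [_ D0 _] := cD; have [k [k1 kD eD]] := const_weight_embeds D0 wD.
  exists (Sim k), D; split=> //=; rewrite k1 /=.
  by have := ha_max kD; lia.
have := card_field_gt1 F; rewrite leq_eqVlt => /predU1P[q2|q2]; last first.
  exact/trans_case/(meets_trans_q_gt2 Delta_gt0 divC q2).
have [/exists_inP[u mu /exists_inP[v mv /exists_inP[w mw]]]|ntr] := boolP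
   [exists u in minw Delta C, [exists v in minw Delta C,
     [exists w in minw Delta C, [&& meets u v, meets v w & ~~ meets u w]]]];
  last first.
  apply: trans_case => u v w mu mv mw uv vw; apply: contraNT ntr => nuw.
  apply/exists_inP; exists u => //; apply/exists_inP; exists v => //.
  by apply/exists_inP; exists w => //; rewrite uv vw nuw.
case/and3P=> uv vw nuw.
have [P0 bP0 P04] := blocks_exist (esym q2) Delta_gt0 divC mu mv mw uv vw nuw.
have [P maxP P0P] := maxset_exists bP0.
have P4 : (4 <= #|P|)%N by apply: leq_trans P04 (subset_leq_card P0P).
move: P4; rewrite leq_eqVlt => /predU1P[P4|P5].
  have [k [D [k3 kD cD eD]]] :=
    reed_muller_component (esym q2) Delta_gt0 divC maxP (esym P4).
  exists (RM k), D; split=> //=; rewrite -q2 k3 /=.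
  by have := @ha_max (k - 2); rewrite -q2 => /(_ kD); lia.
have [D cD eD] := parity_check_component (esym q2) Delta_gt0 divC maxP P5.
exists (PC #|P|.-1), D; split=> //=; rewrite -q2 /=.
apply/andP; split; last by rewrite -ltnS prednK // (leq_trans _ P5).
(* A block has size half of [Delta], so 2 divides [Delta] and [1 <= a]. *)
apply: ha_max; rewrite -q2 expn1.
have [_ cP _] := blocksP _ _ _ (maxsetp maxP).
have /card_gt0P[A AP] : (0 < #|P|)%N by apply: leq_trans P5.
by rewrite -(cP A AP) dvdn_mulr.
Qed.

(** Induction on the dimension: a component [D] is split off, and the generators outside [D] vanish
    on its support. An explicit list [X] is used because filtering it yields the generators of the
    rest. *)
Lemma embedding_exists n (X : seq 'rV[F]_n) :
  divisible_code Delta <<X>>%VS -> (forall c, c \in X -> weight c = Delta) ->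
  exists2 s, all (admissible #|F| a) s &
    embeds (direct_sums [seq summand_code F Delta t | t <- s]) <<X>>%VS.
Proof.
have [N] := ubnP (\dim <<X>>%VS); elim: N X => // N IH X dX divX wX.
have [X0|[w0 w0X]] : X = [::] \/ exists w0, w0 \in X.
  by case: (X) => [|x X']; [left|right; exists x; rewrite mem_head].
  by exists [::] => //=; rewrite X0 span_nil; apply: embeds_zero.
have mX c : c \in X -> minw Delta <<X>>%VS c.
  by move=> cX; rewrite /minw memv_span // wX // eqxx.
have mw0 := mX _ w0X.
have [t [D [at_ [DX D0 cD] eD]]] := component_exists divX mw0.
pose Y := [seq c <- X | c \notin D].
have YX : (<<Y>> <= <<X>>)%VS.
  by apply/span_subvP=> c; rewrite mem_filter => /andP[_ /memv_span].
(* Vanishing on the support of [D] passes from the generators [Y] to their span. *)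
pose Q (v : 'rV[F]_n) :=
  [forall d : 'rV[F]_n, (d \in D) ==> [forall j, (d 0 j != 0) ==> (v 0 j == 0)]].
have QP (v : 'rV[F]_n) :
    reflect (forall (d : 'rV[F]_n) j, d \in D -> d 0 j != 0 -> v 0 j = 0) (Q v).
  apply: (iffP forallP) => [h d j dD dj|h d].
    by have /implyP/(_ dD)/forallP/(_ j)/implyP/(_ dj)/eqP := h d.
  by apply/implyP=> dD; apply/forallP=> j; apply/implyP=> dj; rewrite (h d).
have YQ v : v \in <<Y>>%VS -> Q v.
  apply: span_ind.
  - by apply/QP=> d j _ _; rewrite mxE.
  - move=> u {}v /QP hu /QP hv; apply/QP=> d j dD dj.
    by rewrite mxE (hu d) // (hv d) // addr0.
  - move=> c u /QP hu; apply/QP=> d j dD dj.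
    by rewrite mxE (hu d) // mulr0.
  move=> u; rewrite mem_filter => /andP[uD uX].
  have [uD'|h] := cD u (mX u uX); first by rewrite uD' in uD.
  by apply/QP=> d j dD dj; apply: h dD dj.
have XDY : <<X>>%VS = (D + <<Y>>)%VS.
  apply/eqP; rewrite eqEsubv subv_add DX YX !andbT.
  apply/span_subvP=> c cX; have [cD'|cD'] := boolP (c \in D).
    exact: (subvP (addvSl _ _)).
  by apply: (subvP (addvSr _ _)); apply: memv_span; rewrite mem_filter cD'.
have dY : (\dim <<Y>>%VS < N)%N.
  rewrite -ltnS; apply: leq_trans dX; rewrite ltnS ltn_neqAle dimvS // andbT.
  (* If the dimension did not drop, [D] would lie in the span of [Y], so its words would vanish on
     their own supports. *)
  apply: contraNneq D0 => dE.
  have /eqP XY : (<<Y>> == <<X>>)%VS by rewrite eqEdim YX dE /=.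
  rewrite -subv0; apply/subvP=> d dD; rewrite memv0.
  have /YQ/QP h : d \in <<Y>>%VS by rewrite XY; apply: (subvP DX).
  apply/eqP/rowP=> j; rewrite [RHS]mxE; apply/eqP; apply: contraT => dj.
  by have := dj; rewrite (h d j dD dj) eqxx.
have divY : divisible_code Delta <<Y>>%VS.
  by move=> c cY; apply: divX; apply: (subvP YX).
have [s as_ es] : exists2 s, all (admissible #|F| a) s &
    embeds (direct_sums [seq summand_code F Delta t | t <- s]) <<Y>>%VS.
  by apply: IH => // c; rewrite mem_filter => /andP[_ /wX].
exists (t :: s); first by rewrite /= at_.
rewrite XDY /=; apply: embeds_direct_sum => // c1 c2 j c1D c2Y c1j.
by have /QP := YQ c2 c2Y; apply; first exact: c1D.
Qed.

Lemma decomposition_exists n (C : {vspace 'rV[F]_n}) :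
  divisible_code Delta C -> spanned_by_weight Delta C ->
  exists s, decomposition Delta a (Code C) s.
Proof.
rewrite /spanned_by_weight; set X := [seq c <- _ | _] => divC spC.
have [|c|s as_ es] := @embedding_exists _ X; first by rewrite -spC.
  by rewrite mem_filter => /andP[/andP[_ /eqP]].
by exists s; split=> //; apply: embeds_isomorphic; rewrite spC.
Qed.

End Existence.

(** * Coordinate profiles *)

Section Profiles.
Variable F : finFieldType.

Definition cover_num Delta n (C : {vspace 'rV[F]_n}) (i : 'I_n) : nat :=
  #|[set c : 'rV[F]_n | [&& c \in C, weight c == Delta & c 0 i != 0]]|.

Definition twin_set n (C : {vspace 'rV[F]_n}) (i : 'I_n) : {set 'I_n} :=
  [set j | [forall c : 'rV[F]_n, (c \in C) ==> ((c 0 i != 0) == (c 0 j != 0))]].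

Lemma twin_setP n (C : {vspace 'rV[F]_n}) i j :
  reflect (forall c, c \in C -> (c 0 i != 0) = (c 0 j != 0))
          (j \in twin_set C i).
Proof.
rewrite inE; apply: (iffP forallP) => [h c cC|h c].
  by have /implyP/(_ cC)/eqP := h c.
by apply/implyP=> cC; rewrite h.
Qed.

Definition profile Delta (C : code F) (x y : nat) : nat :=
  (\sum_(i < len C) ((cover_num Delta (words C) i == x) &&
                     (#|twin_set (words C) i| == y)))%N.

(** * Invariance of profiles under semimonomial maps *)

Section Isomorphism.
Variables (C D : code F) (p : 'I_(len D) -> 'I_(len C)) (d : 'I_(len D) -> F)
          (sigma : {rmorphism F -> F}).
Hypotheses (pB : bijective p) (dn : forall i, d i != 0) (sB : bijective sigma)
  (CD : forall w, w \in words D <->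
          exists2 v, v \in words C & w = semimonomial p d sigma v).
Let phi := semimonomial p d sigma.
Let pI := bij_inj pB.

Lemma semimonomial_nz v i : (phi v 0 i != 0) = (v 0 (p i) != 0).
Proof. by rewrite mxE mulf_eq0 (negPf (dn i)) fmorph_eq0. Qed.

Lemma semimonomial_inj : injective phi.
Proof.
move=> u v /rowP h; have [p' pK p'K] := pB; apply/rowP=> j.
have := h (p' j); rewrite !mxE p'K => /(mulfI (dn _)).
exact: (bij_inj sB).
Qed.

Lemma semimonomial_mem v : (phi v \in words D) = (v \in words C).
Proof.
apply/idP/idP=> [/CD[u uC /semimonomial_inj ->] //|vC].
by apply/CD; exists v.
Qed.

Lemma semimonomial_weight v : weight (phi v) = weight v.
Proof.
rewrite /weight -(card_imset _ pI); apply: eq_card => j; rewrite inE.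
have [p' pK p'K] := pB; apply/imsetP/idP=> [[i + ->]|vj].
  by rewrite inE semimonomial_nz.
by exists (p' j); rewrite ?p'K // inE semimonomial_nz p'K.
Qed.

Lemma semimonomial_profile Delta x y : profile Delta C x y = profile Delta D x y.
Proof.
rewrite /profile (reindex p) /=; last exact: onW_bij.
apply: eq_bigr => i _; congr ((_ == x) && (_ == y) : nat).
  rewrite /cover_num -(card_imset _ semimonomial_inj); apply: eq_card => w.
  rewrite inE; apply/imsetP/and3P=> [[v + ->]|[wD ww wi]].
    by rewrite inE semimonomial_mem semimonomial_weight semimonomial_nz => /and3P.
  have /CD[v vC wE] := wD; exists v => //.
  rewrite inE vC -(semimonomial_weight v) -[phi v]wE ww /=.
  by rewrite -(semimonomial_nz v i) -[phi v]wE.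
rewrite -(card_imset (twin_set (words D) i) pI); apply: eq_card => j.
have [p' pK p'K] := pB; apply/idP/imsetP=> [/twin_setP h|[j' /twin_setP h ->]].
  exists (p' j); rewrite ?p'K //; apply/twin_setP=> w /CD[v vC ->].
  by rewrite !semimonomial_nz p'K h.
apply/twin_setP=> v vC; rewrite -!semimonomial_nz; apply: h.
by rewrite semimonomial_mem.
Qed.

Lemma semimonomial_divisible Delta :
  divisible_code Delta (words C) -> divisible_code Delta (words D).
Proof.
by move=> divC w /CD[v vC ->]; rewrite semimonomial_weight; apply: divC.
Qed.

End Isomorphism.

Lemma isomorphic_profile (C D : code F) Delta x y :
  isomorphic C D -> profile Delta C x y = profile Delta D x y.
Proof.
move=> [p [d [s [pB dn sB CD]]]].
exact: (semimonomial_profile pB dn sB CD).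
Qed.

Lemma isomorphic_divisible (C D : code F) Delta : isomorphic C D ->
  divisible_code Delta (words C) -> divisible_code Delta (words D).
Proof.
move=> [p [d [s [pB dn sB CD]]]] divC.
exact: (semimonomial_divisible pB dn CD divC).
Qed.

Lemma divisible_weight_ge n Delta (C : {vspace 'rV[F]_n}) c i :
  divisible_code Delta C -> c \in C -> c 0 i != 0 -> (Delta <= weight c)%N.
Proof.
move=> divC cC ci; apply: dvdn_leq (divC c cC).
by rewrite card_gt0; apply/set0Pn; exists i; rewrite inE.
Qed.

(** * Coordinate invariants of a code extended by zero *)

Section Restriction.
Variables (a N Delta : nat) (A : {vspace 'rV[F]_a}) (E : {vspace 'rV[F]_N}).
Variables (e : 'I_a -> 'I_N) (iota : 'rV[F]_a -> 'rV[F]_N).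
Hypotheses (eI : injective e) (iotaI : injective iota)
  (iota_in : forall c i, iota c 0 (e i) = c 0 i)
  (iota_out : forall c j, j \notin codom e -> iota c 0 j = 0)
  (iota_mem : forall c, c \in A -> iota c \in E)
  (iota_weight : forall c, weight (iota c) = weight c)
  (res : forall v, v \in E -> exists2 c, c \in A & forall i, v 0 (e i) = c 0 i)
  (res_min : forall v i, v \in E -> weight v = Delta -> v 0 (e i) != 0 ->
     exists2 c, c \in A & v = iota c).

(** Every word counted at [e i] comes from [A] by [res_min], so [iota] is a bijection between the
    counted words. *)
Lemma cover_num_restrict i : cover_num Delta E (e i) = cover_num Delta A i.
Proof.
rewrite /cover_num -(card_imset _ iotaI); apply: eq_card => v; rewrite inE.
apply/and3P/imsetP=> [[vE /eqP vw vi]|[c + ->]].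
  have [c cA vc] := res_min vE vw vi; exists c => //.
  by rewrite inE cA -iota_weight -vc vw eqxx -(iota_in c) -vc.
by rewrite inE iota_weight iota_in => /and3P[cA ? ?]; rewrite iota_mem.
Qed.

(** The positive cover number provides a word of [A] nonzero at [i]; its extension vanishes outside
    the image of [e], so no position there is a twin of [e i]. *)
Lemma twin_set_restrict i : (0 < cover_num Delta A i)%N ->
  #|twin_set E (e i)| = #|twin_set A i|.
Proof.
rewrite card_gt0 => /set0Pn[c0]; rewrite inE => /and3P[c0A _ c0i].
rewrite -(card_imset (twin_set A i) eI); apply: eq_card => j.
apply/idP/imsetP=> [/twin_setP h|[j' /twin_setP h ->]].
  have /codomP[j' jE] : j \in codom e.
    apply: contraT => /(iota_out c0) z; have := h _ (iota_mem c0A).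
    by rewrite z iota_in c0i eqxx.
  exists j' => //; apply/twin_setP=> c cA.
  by have := h _ (iota_mem cA); rewrite jE !iota_in.
apply/twin_setP=> v /res[c cA cE]; rewrite !cE; exact: h.
Qed.

Lemma profile_restrict i x y : (0 < x)%N ->
  ((cover_num Delta E (e i) == x) && (#|twin_set E (e i)| == y)) =
  ((cover_num Delta A i == x) && (#|twin_set A i| == y)).
Proof.
move=> x0; rewrite cover_num_restrict; case: eqP => //= xE.
by rewrite twin_set_restrict // xE.
Qed.

End Restriction.

Lemma weight_row_mx n m (c : 'rV[F]_n) (c' : 'rV[F]_m) :
  weight (row_mx c c') = (weight c + weight c')%N.
Proof.
rewrite !weightE big_split_ord /=; congr (_ + _)%N; apply: eq_bigr => i _.
  by rewrite row_mxEl.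
by rewrite row_mxEr.
Qed.

Lemma direct_sum_divisible (C D : code F) Delta :
  divisible_code Delta (words (direct_sum C D)) ->
  divisible_code Delta (words C) /\ divisible_code Delta (words D).
Proof.
move=> h; split=> c cC.
  rewrite -[weight c]addn0 -(weight0 F (len D)) -weight_row_mx; apply: h.
  by apply/mem_direct_sum; exists c, 0; rewrite mem0v.
rewrite -[weight c]add0n -(weight0 F (len C)) -weight_row_mx; apply: h.
by apply/mem_direct_sum; exists 0, c; rewrite mem0v.
Qed.

(** By divisibility, a word of weight [Delta] that is nonzero in one summand vanishes in the other.
    A positive [x] supplies the word that [twin_set_restrict] needs. *)
Lemma profile_direct_sum (C D : code F) Delta x y : (0 < x)%N ->
  divisible_code Delta (words (direct_sum C D)) ->
  profile Delta (direct_sum C D) x y =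
  (profile Delta C x y + profile Delta D x y)%N.
Proof.
move=> x0 /direct_sum_divisible[divC divD].
rewrite /profile big_split_ord /=; congr (_ + _)%N; apply: eq_bigr => i _.
  congr nat_of_bool; apply: (@profile_restrict _ _ _ _ _ _ (fun c => row_mx c 0)).
  - exact: lshift_inj.
  - by move=> c c' /eq_row_mx[].
  - by move=> c j; rewrite row_mxEl.
  - move=> c j; rewrite -[j]splitK; case: (split j) => j' /=.
      by rewrite codom_f.
    by rewrite row_mxEr mxE.
  - by move=> c cC; apply/mem_direct_sum; exists c, 0; rewrite mem0v.
  - by move=> c; rewrite weight_row_mx weight0 addn0.
  - move=> v /mem_direct_sum[c [c' [cC c'D ->]]]; exists c => // j.
    by rewrite row_mxEl.
  - move=> v j /mem_direct_sum[c [c' [cC c'D ->]]]; rewrite row_mxEl.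
    rewrite weight_row_mx => w cj; exists c => //; congr row_mx.
    by apply: weight_eq0; have := divisible_weight_ge divC cC cj; lia.
  - exact: x0.
congr nat_of_bool; apply: (@profile_restrict _ _ _ _ _ _ (fun c => row_mx 0 c)).
- exact: rshift_inj.
- by move=> c c' /eq_row_mx[].
- by move=> c j; rewrite row_mxEr.
- move=> c j; rewrite -[j]splitK; case: (split j) => j' /=; last first.
    by rewrite codom_f.
  by rewrite row_mxEl mxE.
- by move=> c cD; apply/mem_direct_sum; exists 0, c; rewrite mem0v.
- by move=> c; rewrite weight_row_mx weight0.
- move=> v /mem_direct_sum[c [c' [cC c'D ->]]]; exists c' => // j.
  by rewrite row_mxEr.
- move=> v j /mem_direct_sum[c [c' [cC c'D ->]]]; rewrite row_mxEr.
  rewrite weight_row_mx => w cj; exists c' => //; congr row_mx.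
  by apply: weight_eq0; have := divisible_weight_ge divD c'D cj; lia.
- exact: x0.
Qed.

Lemma profile_zero_code z Delta x y : (0 < x)%N ->
  profile Delta (zero_code F z) x y = 0%N.
Proof.
move=> x0; rewrite /profile big1 // => i _.
suff -> : cover_num Delta (words (zero_code F z)) i = 0%N by rewrite ltn_eqF.
apply/eqP; rewrite /cover_num cards_eq0; apply/eqP/setP=> c; rewrite !inE memv0.
by case: eqP => // ->; rewrite mxE eqxx !andbF.
Qed.

Lemma weight_repetition m n (c : 'rV[F]_n) :
  weight (mxvec (\matrix_(i < m) c)) = (m * weight c)%N.
Proof.
rewrite weightE (reindex _ (curry_mxvec_bij _ _)) /=.
transitivity (\sum_(i < m) \sum_(j < n) (c 0%R j != 0%R))%N.
  rewrite pair_bigA; apply: eq_bigr => -[i j] _ /=.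
  by rewrite mxvecE mxE.
by rewrite -weightE sum_nat_const card_ord.
Qed.

Lemma mxvec_rows_inj m n : (0 < m)%N ->
  injective (fun c : 'rV[F]_n => mxvec (\matrix_(i < m) c)).
Proof.
move=> m0 c c' /(can_inj mxvecK)/row_matrixP/(_ (Ordinal m0)).
by rewrite !rowK.
Qed.

Lemma cover_num_repetition m delta (E : code F) a b : (0 < m)%N ->
  cover_num (m * delta)%N (words (repetition m E)) (mxvec_index a b) =
  cover_num delta (words E) b.
Proof.
move=> m0; rewrite /cover_num -(card_imset _ (@mxvec_rows_inj m (len E) m0)).
apply: eq_card => v; rewrite inE.
apply/and3P/imsetP=> [[/mem_repetition[c cE ->]]|[c + ->]].
  rewrite weight_repetition eqn_pmul2l // mxvecE mxE => cw cb.
  by exists c; rewrite // inE cE cw.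
rewrite inE => /and3P[cE cw cb]; rewrite weight_repetition eqn_pmul2l //.
by split=> //; [apply/mem_repetition; exists c|rewrite mxvecE mxE].
Qed.

Lemma twin_set_repetition m (E : code F) a b :
  #|twin_set (words (repetition m E)) (mxvec_index a b)| =
  (m * #|twin_set (words E) b|)%N.
Proof.
have [g gK Kg] := curry_mxvec_bij m (len E).
have uI : injective (uncurry (@mxvec_index m (len E))).
  by move=> x y h; rewrite -(gK x isT) h gK.
have <- : #|setX [set: 'I_m] (twin_set (words E) b)| =
    (m * #|twin_set (words E) b|)%N by rewrite cardsX cardsT card_ord.
rewrite -(card_imset _ uI).
apply: eq_card => j; case/mxvec_indexP: j => a' b'.
apply/twin_setP/imsetP=> [h|[[a2 b2] + /= e]].
  exists (a', b') => //; rewrite in_setX in_setT; apply/twin_setP=> c cE.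
  have := h (mxvec (\matrix_(i < m) c)); rewrite !mxvecE !mxE; apply.
  by apply/mem_repetition; exists c.
have [-> ->] := uI (a', b') (a2, b2) e.
rewrite in_setX => /andP[_ /twin_setP h] v /mem_repetition[c cE ->].
by rewrite !mxvecE !mxE; apply: h.
Qed.

Lemma repetition_invariants m delta (E : code F) Delta x :
  (0 < m)%N -> (m * delta)%N = Delta ->
  (forall b, cover_num delta (words E) b = x) ->
  (forall b, #|twin_set (words E) b| = 1%N) ->
  forall i, cover_num Delta (words (repetition m E)) i = x /\
            #|twin_set (words (repetition m E)) i| = m.
Proof.
move=> m0 <- cE tE i; case/mxvec_indexP: i => i b.
by rewrite cover_num_repetition // cE twin_set_repetition tE muln1.
Qed.

End Profiles.

(** * Invariants of simplex, Reed-Muller and parity check codes *)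

Section SummandProfiles.
Variable F : finFieldType.

Lemma dot_simplex k (u : 'rV[F]_k) b :
  (u *m simplex_mx F k) 0 b = dot u (vpick (nth 0%VS (lines F k) b)).
Proof. by rewrite -dot_col col_simplex_mx. Qed.

Lemma nth_lines k (b : 'I_(size (lines F k))) :
  let x := vpick (nth 0%VS (lines F k) b) in
  x != 0 /\ nth 0%VS (lines F k) b = <[x]>%VS.
Proof. by apply: vpick_line; rewrite mem_nth. Qed.

Lemma line_of_vector k (x : 'cV[F]_k) : x != 0 -> exists b c, c != 0 /\
  x = c *: vpick (nth 0%VS (lines F k) (b : 'I_(size (lines F k)))).
Proof.
move=> x0; have xl : <[x]>%VS \in lines F k by rewrite mem_lines dim_vline x0.
have lt : (index <[x]>%VS (lines F k) < size (lines F k))%N by rewrite index_mem.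
exists (Ordinal lt); have [_ /=] := nth_lines (Ordinal lt).
rewrite nth_index // => xE.
have /vlineP[c hc] : x \in <[vpick <[x]>]>%VS by rewrite -xE memv_line.
exists c; split=> //.
by apply: contraNneq x0 => c0; rewrite hc c0 scale0r.
Qed.

(** A nonzero position of the word is a line outside the kernel of [u], and so contributes q - 1
    vectors outside this kernel; [g] matches pairs of such a line and a nonzero scalar with all
    vectors outside the kernel. *)
Lemma simplex_weight k (u : 'rV[F]_k) : u != 0 ->
  weight (u *m simplex_mx F k) = (#|F| ^ (k - 1))%N.
Proof.
move=> u0; have k0 : (0 < k)%N.
  by case: k u u0 => [|//] u; rewrite (thinmx0 u) eqxx.
have q1 := card_field_gt1 F.
pose g (z : 'I_(size (lines F k)) * F) := z.2 *: vpick (nth 0%VS (lines F k) z.1).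
pose S := setX [set b | (u *m simplex_mx F k) 0 b != 0] [set~ (0 : F)].
have gI : {in S &, injective g}.
  move=> [b c] [b' c']; rewrite !in_setX !inE /g /=.
  move=> /andP[_ c0] /andP[_ c0'] e.
  have [b0 bE] := nth_lines b; have [b0' bE'] := nth_lines b'.
  have bb' : b = b'.
    apply/val_inj/eqP; rewrite /= -(@nth_uniq _ 0%VS (lines F k)) ?undup_uniq //.
    rewrite bE bE' eqEdim !dim_vline b0 b0' -memvE andbT; apply/vlineP.
    exists (c^-1 * c'); rewrite -scalerA -e scalerA mulVf ?scale1r //.
  move: e; rewrite -bb' => /eqP; rewrite -subr_eq0 -scalerBl scaler_eq0.
  by rewrite (negPf b0) orbF subr_eq0 => /eqP ->.
have gS : [set g z | z in S] = [set x | dot u x != 0].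
  apply/setP=> x; rewrite inE; apply/imsetP/idP=> [[[b c]]|ux].
    rewrite in_setX !inE /g /= => /andP[ub c0] ->.
    by rewrite dotZr mulf_neq0 // -dot_simplex.
  have x0 : x != 0 by apply: contraNneq ux => ->; rewrite dot0r.
  have [b [c [c0 xE]]] := line_of_vector x0; exists (b, c) => //.
  rewrite in_setX !inE c0 andbT dot_simplex; apply: contraNneq ux => h.
  by rewrite xE dotZr h mulr0.
have := card_in_imset gI; rewrite gS cardsX cardsC1.
have := @card_affine_kernel F k u 0 u0.
have -> : [set x | dot u x + 0 == 0] = ~: [set x | dot u x != 0].
  by apply/setP=> x; rewrite !inE addr0 negbK.
have := cardsC [set x | dot u x != 0]; rewrite card_mx muln1.
have -> : (#|F| ^ k = #|F| * #|F| ^ (k - 1))%N by rewrite -expnS subn1 prednK.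
rewrite -/(weight (u *m simplex_mx F k)).
move: (#|F| ^ (k - 1))%N => K.
move: #|F| q1 (weight _) #|~: _| #|_| => q q1 w b c h1 h2 h3.
have {}h2 : K = b by apply/eqP; rewrite -(@eqn_pmul2l q) ?h2 //; lia.
rewrite -{}h2 {b} in h1; rewrite {}h3 {c} in h1.
apply/eqP; rewrite -(@eqn_pmul2r q.-1); last by lia.
by apply/eqP; move: h1; case: q q1 => // q _ /=; rewrite mulSn; lia.
Qed.

Lemma simplex_mx_inj k : injective (fun u : 'rV[F]_k => u *m simplex_mx F k).
Proof.
move=> u v /= e; apply/eqP; rewrite -subr_eq0; apply: contraT => uv.
have [x ux] := dot_nzl uv.
have x0 : x != 0 by apply: contraNneq ux => ->; rewrite dot0r.
have [b [c [c0 xE]]] := line_of_vector x0; move: ux.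
by rewrite xE dotZr -dot_simplex mulmxBl e subrr mxE mulr0 eqxx.
Qed.

Lemma cover_num_simplex k b :
  cover_num (#|F| ^ (k - 1))%N (words (simplex_code F k)) b =
  (#|F| ^ k - #|F| ^ k.-1)%N.
Proof.
have [b0 _] := nth_lines b.
rewrite -(card_dot_nz b0) /cover_num -(card_imset _ (@simplex_mx_inj k)).
apply: eq_card => w; rewrite inE.
apply/and3P/imsetP=> [[/mem_generated_code[u ->] _ ub]|[u + ->]].
  by exists u; rewrite // inE -dot_simplex.
rewrite inE => ub; rewrite dot_simplex simplex_weight ?eqxx //.
  by split=> //; apply/mem_generated_code; exists u.
by apply: contraNneq ub => ->; rewrite /dot mul0mx mxE.
Qed.

(** Distinct positions belong to distinct lines, and some form vanishes on the first but not on the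
    second. *)
Lemma twin_set_simplex k b : #|twin_set (words (simplex_code F k)) b| = 1%N.
Proof.
apply/eqP/cards1P; exists b; apply/setP=> j; rewrite in_set1.
apply/twin_setP/eqP=> [h|-> //]; apply/eqP; apply: contraT => jb.
have [b0 bE] := nth_lines b; have [j0 jE] := nth_lines j.
have [|u [ub uj]] := dot_separates (y := vpick (nth 0%VS (lines F k) j)) b0.
  rewrite memv_line_nz // -bE -jE nth_uniq ?undup_uniq //.
have := h (u *m simplex_mx F k); rewrite !dot_simplex ub uj eqxx.
by move=> h'; have : false = true by apply: h'; apply/mem_generated_code; exists u.
Qed.

Lemma reed_mullerE k (u : 'rV[F]_k) (s : 'M[F]_1) b :
  (row_mx u s *m reed_muller_mx F k.+1) 0 b = dot u (enum_val b) + s 0 0.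
Proof.
rewrite mul_row_col mxE; congr (_ + _); last by rewrite mxE big_ord1 mxE mulr1.
by rewrite dotE mxE; apply: eq_bigr => i _; rewrite mxE.
Qed.

Section Binary.
Hypothesis q2 : #|F| = 2.

Lemma reed_muller_weight k (u : 'rV[F]_k) (s : 'M[F]_1) : u != 0 ->
  weight (row_mx u s *m reed_muller_mx F k.+1) = (2 ^ (k - 1))%N.
Proof.
move=> u0; have k0 : (0 < k)%N.
  by case: k u u0 => [|//] u; rewrite (thinmx0 u) eqxx.
rewrite /weight -(card_imset _ (@enum_val_inj _ _)).
have -> : [set enum_val b | b in
      [set i | (row_mx u s *m reed_muller_mx F k.+1) 0 i != 0]]
    = [set x | dot u x + s 0 0 != 0].
  apply/setP=> x; rewrite inE; apply/imsetP/idP=> [[b + ->]|ux].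
    by rewrite inE reed_mullerE.
  by exists (enum_rank x); rewrite ?enum_rankK // inE reed_mullerE enum_rankK.
have := @card_affine_kernel F k u (s 0 0) u0.
have -> : [set x | dot u x + s 0 0 == 0] = ~: [set x | dot u x + s 0 0 != 0].
  by apply/setP=> x; rewrite !inE negbK.
have := cardsC [set x | dot u x + s 0 0 != 0]; rewrite card_mx muln1 q2.
have -> : (2 ^ k = 2 * 2 ^ (k - 1))%N by rewrite -expnS subn1 prednK.
by card_lia.
Qed.

(** For each [u] exactly one constant term makes the word 1 at position [b]. The resulting words all
    have weight 2 ^ (k - 1), except for [u = 0], which gives the all-one word of weight 2 ^ k. *)
Lemma cover_num_reed_muller k b : (0 < k)%N ->
  cover_num (2 ^ (k - 1))%N (words (reed_muller_code F k.+1)) b = (2 ^ k)%N.-1.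
Proof.
move=> k0; pose g (u : 'rV[F]_k) :=
  row_mx u (1 - dot u (enum_val b))%:M *m reed_muller_mx F k.+1.
have gE u b' : g u 0 b' = dot u (enum_val b') + (1 - dot u (enum_val b)).
  by rewrite reed_mullerE mxE eqxx.
have gI : injective g.
  move=> u v e; apply/rowP=> i; rewrite -!dot_deltar.
  have h x :
      dot u x + (1 - dot u (enum_val b)) = dot v x + (1 - dot v (enum_val b)).
    have := gE u (enum_rank x); rewrite enum_rankK => <-.
    by rewrite e gE enum_rankK.
  have := h 0; rewrite !dot0r !add0r => h0.
  by have := h (delta_mx i 0); rewrite h0 => /addIr.
have -> : (2 ^ k).-1 = #|[set~ (0 : 'rV[F]_k)]|.
  by rewrite cardsC1 card_mx mul1n q2.
rewrite /cover_num -(card_imset _ gI); apply: eq_card => w; rewrite inE.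
apply/and3P/imsetP=> [[/mem_generated_code[us ->] /eqP ww wb]|[u + ->]].
  move: ww wb; rewrite -(hsubmxK us).
  set u := lsubmx us; set s := rsubmx us => ww wb; exists u.
    rewrite !inE; apply/eqP=> u0; move: ww; rewrite u0 /weight.
    have s1 : s 0 0 != 0.
      by move: wb; rewrite reed_mullerE u0 /dot mul0mx mxE add0r.
    have -> : [set i |
        (row_mx (0 : 'rV_k) s *m reed_muller_mx F k.+1) 0 i != 0] = setT.
      by apply/setP=> i; rewrite !inE reed_mullerE /dot mul0mx mxE add0r s1.
    have -> : #|[set: 'I_(len (reed_muller_code F k.+1))]| = (2 ^ k)%N.
      by rewrite cardsT card_ord len_reed_muller_code q2.
    have -> : (2 ^ k = 2 * 2 ^ (k - 1))%N by rewrite -expnS subn1 prednK.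
    have : (0 < 2 ^ (k - 1))%N by rewrite expn_gt0.
    by move: (2 ^ (k - 1))%N; clear; lia.
  apply/rowP=> j; rewrite gE reed_mullerE; congr (_ + _).
  have := F2_neq0 q2 wb; rewrite reed_mullerE => <-.
  by rewrite addrC addKr.
rewrite !inE => u0; split.
- by apply/mem_generated_code; eexists.
- by rewrite reed_muller_weight.
- by rewrite gE addrC subrK oner_neq0.
Qed.

Lemma twin_set_reed_muller k b :
  #|twin_set (words (reed_muller_code F k.+1)) b| = 1%N.
Proof.
apply/eqP/cards1P; exists b; apply/setP=> j; rewrite in_set1.
apply/twin_setP/eqP=> [h|-> //]; apply/eqP; apply: contraT => jb.
have [|u ux] := @dot_nz F k (enum_val j - enum_val b).
  by rewrite subr_eq0 (inj_eq enum_val_inj).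
pose s : 'M[F]_1 := (- dot u (enum_val b))%:M.
have := h (row_mx u s *m reed_muller_mx F k.+1).
rewrite !reed_mullerE !mxE eqxx mulr1n subrr eqxx.
have -> : dot u (enum_val j) - dot u (enum_val b) != 0.
  by move: ux; rewrite dotDr -scaleN1r dotZr mulN1r.
move=> h'; have : false = true by apply: h'; apply/mem_generated_code; eexists.
by [].
Qed.

Lemma supp_parity2 k (b j : 'I_k.+1) : b != j ->
  supp (delta_mx 0 b + delta_mx 0 j : 'rV[F]_k.+1) = [set b; j].
Proof.
move=> bj; apply/setP=> i; rewrite !inE !mxE !eqxx /=.
have [->|ib] := eqVneq i b; first by rewrite (negPf bj) addr0 oner_eq0.
by rewrite add0r; case: (i == j); rewrite ?oner_eq0 ?eqxx.
Qed.

Lemma cover_num_parity_check k b :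
  cover_num 2%N (words (parity_check_code F k)) b = k.
Proof.
pose g (j : 'I_k.+1) : 'rV[F]_k.+1 := delta_mx 0 b + delta_mx 0 j.
have gI : {in [set~ b] &, injective g}.
  move=> i j; rewrite !inE => ib jb /addrI/rowP/(_ i)/eqP.
  by rewrite !mxE !eqxx /=; case: (i =P j) => //; rewrite oner_eq0.
transitivity #|[set~ b]|; last by rewrite cardsC1 card_ord.
rewrite -[in RHS](card_in_imset gI) /cover_num; apply: eq_card => w; rewrite inE.
apply/and3P/imsetP=> [[_ /eqP ww wb]|[j + ->]].
  have bw : b \in supp w by rewrite inE.
  have /cards1P[j hj] : #|supp w :\ b| == 1%N.
    by have := cardsD1 b (supp w); rewrite bw card_supp ww add1n => -[<-].
  have jb : j \in [set~ b].
    by have : j \in supp w :\ b by [rewrite hj set11]; rewrite !inE => /andP[].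
  exists j => //; rewrite -(indK q2 w) -(indK q2 (g j)).
  rewrite supp_parity2; last by move: jb; rewrite !inE eq_sym.
  by rewrite -(setD1K bw) hj.
rewrite !inE => jb; have bj : b != j by rewrite eq_sym.
rewrite -card_supp supp_parity2 // cards2 bj mem_parity2 //; split=> //.
have : b \in supp (g j) by rewrite supp_parity2 // !inE eqxx.
by rewrite inE.
Qed.

(** There are at least three positions, so some [l] differs from [b] and [j], and the word supported
    on [b] and [l] tells [b] from [j]. *)
Lemma twin_set_parity_check k b : (2 <= k)%N ->
  #|twin_set (words (parity_check_code F k)) b| = 1%N.
Proof.
move=> k2; apply/eqP/cards1P; exists b; apply/setP=> j; rewrite in_set1.
apply/twin_setP/eqP=> [h|-> //]; apply/eqP; apply: contraT => jb.
have /card_gt0P[l] : (0 < #|~: [set b; j]|)%N.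
  have := cardsC [set b; j]; rewrite cards2 card_ord eq_sym jb /=.
  by move: k2; clear; case: #|_| => //; lia.
rewrite !inE negb_or => /andP[lb lj]; have bl : b != l by rewrite eq_sym.
have := h _ (mem_parity2 q2 bl).
have hb i : ((delta_mx 0 b + delta_mx 0 l : 'rV[F]_k.+1) 0 i != 0) =
    (i \in [set b; l]).
  by rewrite -(supp_parity2 bl) inE.
by rewrite !hb !inE eqxx (negPf jb) (eq_sym j) (negPf lj).
Qed.

End Binary.
End SummandProfiles.

(** * Uniqueness *)

Section Uniqueness.
Variables (F : finFieldType) (Delta a : nat).
Hypotheses (Delta_gt0 : (0 < Delta)%N) (ha : (#|F| ^ a %| Delta)%N).

(** The exponent of q in the divisor of [Delta] that gives the number of repetitions; [RM] and [PC]
    are admissible only for q = 2, so powers of q also express their powers of 2. *)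
Definition summand_exponent (t : summand) : nat :=
  match t with Sim k => k - 1 | RM k => k - 2 | PC _ => 1 end.

Definition summand_cover (t : summand) : nat :=
  match t with
  | Sim k => #|F| ^ k - #|F| ^ k.-1
  | RM k => (2 ^ k.-1).-1
  | PC k => k
  end.

Definition summand_mult (t : summand) : nat :=
  (Delta %/ #|F| ^ summand_exponent t)%N.

Lemma summand_multK t : admissible #|F| a t ->
  (summand_mult t * #|F| ^ summand_exponent t)%N = Delta.
Proof.
move=> at_; apply: divnK; apply: dvdn_trans ha; apply: dvdn_exp2l.
by case: t at_ => k /=; lia.
Qed.

Lemma summand_mult_gt0 t : admissible #|F| a t -> (0 < summand_mult t)%N.
Proof.
by move=> /summand_multK h; move: Delta_gt0; rewrite -h muln_gt0 => /andP[].
Qed.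

Lemma summand_cover_gt0 t : admissible #|F| a t -> (0 < summand_cover t)%N.
Proof.
have q1 := card_field_gt1 F; case: t => k /=.
- case: k => // k _; rewrite subn_gt0 ltn_exp2l //.
- case/and3P=> _ k3 _; rewrite -subn1 subn_gt0 -(expn0 2) ltn_exp2l //; lia.
- by case/and3P=> _ _; apply: leq_trans.
Qed.

Lemma summand_code_invariants t : admissible #|F| a t ->
  (0 < len (summand_code F Delta t))%N /\
  forall i, cover_num Delta (words (summand_code F Delta t)) i = summand_cover t
    /\ #|twin_set (words (summand_code F Delta t)) i| = summand_mult t.
Proof.
move=> at_; have m0 := summand_mult_gt0 at_; have mK := summand_multK at_.
case: t at_ m0 mK => k; rewrite /summand_mult /=.
- move=> /andP[k1 _] m0 mK; split.
    rewrite muln_gt0 m0 /=.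
    have [|b _] := @line_of_vector F k (const_mx 1).
      by apply/eqP=> /colP/(_ (Ordinal k1))/eqP; rewrite !mxE oner_eq0.
    exact: leq_ltn_trans (ltn_ord b).
  apply: (repetition_invariants (E := simplex_code F k) m0 mK) => b.
    exact: cover_num_simplex.
  exact: twin_set_simplex.
- case: k => [|k] /and3P[/eqP q2 k3 _] //; rewrite q2 => m0 mK; split.
    rewrite muln_gt0 m0 -[X in (0 < X)%N]/(len (reed_muller_code F k.+1)).
    by rewrite len_reed_muller_code q2 expn_gt0.
  apply: (repetition_invariants (E := reed_muller_code F k.+1) m0 mK) => b.
    by apply: cover_num_reed_muller => //; lia.
  exact: twin_set_reed_muller.
- move=> /and3P[/eqP q2 _ k4]; rewrite q2 expn1 => m0 mK; split.
    by rewrite muln_gt0 m0.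
  apply: (repetition_invariants (E := parity_check_code F k) m0 mK) => b.
    exact: cover_num_parity_check.
  by apply: twin_set_parity_check => //; lia.
Qed.

(** Equal multiplicities give equal exponents e. For q = 2 the cover numbers at exponent e are 2 ^ e
    for [Sim] and 2 ^ (e + 1) - 1 for [RM], which differ since [RM] has e >= 1; [PC k] has e = 1,
    where these two values are 2 and 3, whereas its own is k >= 4. *)
Lemma summand_invariants_inj t t' :
  admissible #|F| a t -> admissible #|F| a t' ->
  summand_cover t = summand_cover t' -> summand_mult t = summand_mult t' ->
  t = t'.
Proof.
move=> at_ at' ce me.
have ee : summand_exponent t = summand_exponent t'.
  apply/eqP; rewrite -(eqn_exp2l _ _ (card_field_gt1 F)).
  by rewrite -(eqn_pmul2l (summand_mult_gt0 at_)) {2}me !summand_multK.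
case: t t' at_ at' ce ee {me} => [k|k|k] [k'|k'|k'] /=.
- by move=> *; congr Sim; lia.
- case: k => // k _ /and3P[/eqP -> k3 _]; rewrite subn1 /= => + kE.
  have -> : k'.-1 = k.+1 by lia.
  have : (1 < 2 ^ k)%N by rewrite -{1}(expn0 2) ltn_exp2l //; lia.
  by rewrite expnS; move: (2 ^ k)%N; lia.
- move=> _ /and3P[/eqP -> _ k4] + kE; have -> : k = 2 by lia.
  by rewrite /=; lia.
- case: k' => // k' /and3P[/eqP -> k3 _] _; rewrite subn1 /= => + kE.
  have -> : k.-1 = k'.+1 by lia.
  have : (1 < 2 ^ k')%N by rewrite -{1}(expn0 2) ltn_exp2l //; lia.
  by rewrite expnS; move: (2 ^ k')%N; lia.
- by move=> *; congr RM; lia.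
- move=> _ /and3P[_ _ k4] + kE; have -> : k = 3 by lia.
  by rewrite /=; lia.
- move=> /and3P[/eqP -> _ k4] _ + kE; have -> : k' = 2 by lia.
  by rewrite /=; lia.
- move=> /and3P[_ _ k4] _ + kE; have -> : k' = 3 by lia.
  by rewrite /=; lia.
- by move=> _ _ ->.
Qed.

Lemma profile_summand t t' : admissible #|F| a t -> admissible #|F| a t' ->
  profile Delta (summand_code F Delta t') (summand_cover t) (summand_mult t) =
  ((t' == t) * len (summand_code F Delta t))%N.
Proof.
move=> at_ at'; have [_ h] := summand_code_invariants at'.
rewrite /profile (eq_bigr (fun=> (t' == t) : nat)) => [|i _].
  rewrite sum_nat_const card_ord; case: eqP => [->|]; first by rewrite muln1 mul1n.
  by rewrite muln0.
have [-> ->] := h i; congr nat_of_bool; apply/andP/eqP=> [[/eqP ce /eqP me]|->//].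
exact: summand_invariants_inj.
Qed.

Lemma profile_direct_sums t s : admissible #|F| a t ->
  all (admissible #|F| a) s ->
  divisible_code Delta (words (direct_sums [seq summand_code F Delta t | t <- s])) ->
  profile Delta (direct_sums [seq summand_code F Delta t | t <- s])
    (summand_cover t) (summand_mult t) =
  (count_mem t s * len (summand_code F Delta t))%N.
Proof.
move=> at_; have x0 := summand_cover_gt0 at_.
elim: s => [_ _|t' s IH /andP[at' as_] divs] /=; first by rewrite profile_zero_code.
rewrite profile_direct_sum // mulnDl profile_summand //.
by rewrite IH //; case/direct_sum_divisible: divs.
Qed.

(** The profile of [C] at the invariants of a summand [r] is the number of occurrences of [r] times
    its length, which is positive, so [C] determines every multiplicity. Zero positions have cover
    number 0 and are not counted. *)
Lemma decomposition_unique n (C : {vspace 'rV[F]_n}) s t :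
  divisible_code Delta C ->
  decomposition Delta a (Code C) s -> decomposition Delta a (Code C) t ->
  perm_eq s t.
Proof.
move=> divC ds dt.
have profC s' r : decomposition Delta a (Code C) s' -> admissible #|F| a r ->
    profile Delta (Code C) (summand_cover r) (summand_mult r) =
    (count_mem r s' * len (summand_code F Delta r))%N.
  move=> [as_ [z iso]] ar; have r0 := summand_cover_gt0 ar.
  have divT := isomorphic_divisible iso divC.
  rewrite (isomorphic_profile _ _ _ iso) profile_direct_sum //.
  rewrite profile_zero_code // addn0 profile_direct_sums //.
  by case/direct_sum_divisible: divT.
apply/allP=> r; rewrite mem_cat => rst.
have ar : admissible #|F| a r.
  by case/orP: rst; [case: ds => /allP h _ /h|case: dt => /allP h _ /h].
have [l0 _] := summand_code_invariants ar.
by rewrite /= -(eqn_pmul2r l0) -!profC.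
Qed.

End Uniqueness.

Theorem theorem1 (F : finFieldType) (Delta a : nat)
    (hDelta : (0 < Delta)%N)
    (ha : (#|F| ^ a %| Delta)%N)
    (ha_max : forall b : nat, (#|F| ^ b %| Delta)%N -> (b <= a)%N)
    (n : nat) (C : {vspace 'rV[F]_n})
    (hdiv : divisible_code Delta C)
    (hspan : spanned_by_weight Delta C) :
  (exists s : seq summand, decomposition Delta a (Code C) s) /\
  (forall s t : seq summand,
     decomposition Delta a (Code C) s -> decomposition Delta a (Code C) t ->
     perm_eq s t).
Proof.
split; first exact: decomposition_exists.
by move=> s t; apply: decomposition_unique.
Qed.
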